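(* Let $n\ge 1$, let $\boldsymbol{a},\boldsymbol{b}\in\mathbb{R}^n$ with $a_i<b_i$ for all $i$, and let $f:[\boldsymbol{a},\boldsymbol{b}]\to\mathbb{R}$ be a jointly monotone increasing function on the rectangle $[\boldsymbol{a},\boldsymbol{b}]=\prod_{i=1}^n[a_i,b_i]$. Then $f$ is absolutely continuous on $[\boldsymbol{a},\boldsymbol{b}]$ if and only if $$\int_{[\boldsymbol{a},\boldsymbol{b}]} f^{(n)}(\boldsymbol{x})\,d\boldsymbol{x}= \Delta_f^n[\boldsymbol{a},\boldsymbol{b}].$$
   Context: For $\boldsymbol{c},\boldsymbol{d}\in\mathbb{R}^n$, $\boldsymbol{c}\le\boldsymbol{d}$ means $c_i\le d_i$ for all $i$, and $[\boldsymbol{c},\boldsymbol{d}]=\prod_i[c_i,d_i]$. The joint increment of $f$ over $[\boldsymbol{c},\boldsymbol{d}]$ is $$\Delta_f^n[\boldsymbol{c},\boldsymbol{d}]=\sum_{\epsilon_1,\dots,\epsilon_n\in\{0,1\}}(-1)^{n+\epsilon_1+\dots+\epsilon_n}f\big(c_1+\epsilon_1(d_1-c_1),\dots,c_n+\epsilon_n(d_n-c_n)\big).$$ $f$ is jointly monotone increasing on $[\boldsymbol{a},\boldsymbol{b}]$ if $\Delta_f^n[\boldsymbol{x},\boldsymbol{y}]\ge 0$ for all $\boldsymbol{x}\le\boldsymbol{y}$ in $[\boldsymbol{a},\boldsymbol{b}]$. The joint derivative of $f$ at a point $\boldsymbol{x}$ in a neighborhood of which $f$ is defined is $$f^{(n)}(\boldsymbol{x})=\lim_{h\to0^+}\frac{\Delta_f^n\big([x_1,x_1+h]\times\dots\times[x_n,x_n+h]\big)}{h^n},$$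 when the limit exists (as a finite real number); for jointly monotone increasing $f$ it exists almost everywhere in $[\boldsymbol{a},\boldsymbol{b}]$ and is Lebesgue integrable. $f$ is absolutely continuous on $[\boldsymbol{a},\boldsymbol{b}]$ if for every $\varepsilon>0$ there is $\delta>0$ such that for every finite collection of closed sub-rectangles $I_1,\dots,I_N\subset[\boldsymbol{a},\boldsymbol{b}]$ (with sides parallel to the axes) with pairwise disjoint interiors and $\sum_{i=1}^N m(I_i)<\delta$ one has $\sum_{i=1}^N|\Delta_f^nI_i|<\varepsilon$, where $m$ is $n$-dimensional Lebesgue measure. *)

(* Defs.v *)
From HB Require Import structures.
From mathcomp Require Import all_boot all_order all_algebra.
From mathcomp Require Import all_classical all_reals all_analysis.

Set Implicit Arguments.
Unset Strict Implicit.
Unset Printing Implicit Defensive.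

Import Order.TTheory GRing.Theory Num.Theory.
Import numFieldNormedType.Exports.

Local Open Scope classical_set_scope.
Local Open Scope ring_scope.

Section rectangles.
Context {R : realType} {n : nat}.
Implicit Types (c d x : 'rV[R]_n).

Definition vle c d : Prop := forall i, c ord0 i <= d ord0 i.

Definition box c d : set 'rV[R]_n := [set x | vle c x /\ vle x d].

Definition box_volume c d : R := \prod_(i < n) (d ord0 i - c ord0 i).

End rectangles.

(* The library has Lebesgue measure on the line only. In dimension n.+1 it is
   obtained here by Caratheodory's method: the outer measure is the infimum of
   the total volume over countable coverings by closed rectangles, and the
   measure is its restriction to the (complete) sigma-algebra of Caratheodory
   measurable sets, i.e. of Lebesgue measurable sets. In dimension 0 coverings
   by countably infinite sequences of rectangles would give the empty set
   infinite outer measure, whence n.+1. *)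
Section lebesgue_outer.
Context (R : realType) (n : nat).
Implicit Types (X : set 'rV[R]_n.+1)
  (B : nat -> 'rV[R]_n.+1 * 'rV[R]_n.+1).
Local Open Scope ereal_scope.

Definition box_cover X := [set B : nat -> 'rV[R]_n.+1 * 'rV[R]_n.+1 |
  (forall k, vle (B k).1 (B k).2) /\ X `<=` \bigcup_k box (B k).1 (B k).2].

Definition lebesgue_outer X : \bar R :=
  ereal_inf [set \sum_(k <oo) (box_volume (B k).1 (B k).2)%:E
            | B in box_cover X].

Let vol (p : 'rV[R]_n.+1 * 'rV[R]_n.+1) : \bar R :=
  (if `[< vle p.1 p.2 >] then box_volume p.1 p.2 else 0%R)%:E.

Let vol_ge0 p : 0 <= vol p.
Proof.
rewrite lee_fin; case: asboolP => // le12.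
by apply: prodr_ge0 => i _; rewrite subr_ge0; exact: le12.
Qed.

Let volE X B : box_cover X B ->
  \sum_(k <oo) (box_volume (B k).1 (B k).2)%:E = \sum_(k <oo) vol (B k).
Proof.
by case=> le12 _; apply: eq_eseriesr => k _; rewrite /vol asboolT.
Qed.

Lemma lebesgue_outer_ge0 X : 0 <= lebesgue_outer X.
Proof.
apply: le_ereal_inf_tmp => x [B XB <-]; rewrite (volE XB).
exact: nneseries_ge0.
Qed.

Lemma le_lebesgue_outer :
  {homo lebesgue_outer : X Y / X `<=` Y >-> X <= Y}.
Proof.
move=> X Y XY; apply: ereal_inf_le_tmp => x [B [leB YB] <-].
by exists B => //; split => //; exact: subset_trans YB.
Qed.

Lemma lebesgue_outer0 : lebesgue_outer set0 = 0.
Proof.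
apply/eqP; rewrite eq_le lebesgue_outer_ge0 andbT.
apply: ereal_inf_lbound; exists (fun=> (0%R, 0%R)).
  by split=> // k i /=.
apply: eseries0 => k _ _ /=.
by rewrite /box_volume big_ord_recl subrr mul0r.
Qed.

Lemma lebesgue_outer_sigma_subadditive : sigma_subadditive lebesgue_outer.
Proof.
move=> A; have [[i ioo]|] := pselect (exists i, lebesgue_outer (A i) = +oo).
  rewrite (eseries_pinfty _ _ ioo) ?leey// => k _.
  by rewrite -ltNye (lt_le_trans _ (lebesgue_outer_ge0 _)).
rewrite -forallNE => Aoo.
suff add2e (e : {posnum R}) : lebesgue_outer (\bigcup_k A k) <=
    \sum_(i <oo) lebesgue_outer (A i) + e%:num%:E.
  by apply/lee_addgt0Pr => _/posnumP[].
rewrite (le_trans _ (epsilon_trick _ _ _))//; last first.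
  by move=> k; exact: lebesgue_outer_ge0.
pose P k B := box_cover (A k) B /\
  \sum_(j <oo) vol (B j) <= lebesgue_outer (A k) + (e%:num / (2 ^ k.+1)%:R)%:E.
have [G PG] : {G & forall k, P k (G k)}.
  apply: (@choice _ _ P) => k.
  have e0 : (0 < e%:num / (2 ^ k.+1)%:R)%R by [].
  have fk : lebesgue_outer (A k) \is a fin_num.
    by rewrite ge0_fin_numE ?lebesgue_outer_ge0// ltey; exact/eqP/Aoo.
  have [x [B AB <-] xS] := lb_ereal_inf_adherent e0 fk.
  by exists B; split => //; rewrite -(volE AB); exact/ltW.
apply: (@le_trans _ _ (\esum_(i in setT) (vol \o uncurry G) i)).
  have /card_esym/ppcard_eqP[f] := card_nat2.
  have fG : box_cover (\bigcup_k A k) (uncurry G \o f).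
    split => [i|t [i _]] /=; first by case: (f i) => p q; exact: (PG p).1.1.
    move=> /((PG i).1.2) [j _ Gij]; exists (f^-1%FUN (i, j)) => //=.
    by rewrite invK ?inE.
  apply: (@le_trans _ _ (\sum_(k <oo) vol ((uncurry G \o f) k))).
    by apply: ereal_inf_lbound; exists (uncurry G \o f) => //; rewrite (volE fG).
  rewrite -(esum_pred_image (vol \o uncurry G) _ xpredT) ?[fun=> _]set_true//.
    by rewrite image_eq.
  by move=> k _; exact: vol_ge0.
rewrite (_ : esum _ _ = \esum_(i in setT) \esum_(j in setT) vol (G i j));
  last first.
  rewrite (esum_esum (J := fun=> setT) (a := fun i j => vol (G i j)))//.
  by apply: esym; congr esum; [apply/seteqP; split | apply/funext => -[]].
rewrite -nneseries_esumT; last by move=> i; exact: esum_ge0.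
apply: lee_nneseries => i _; first by move=> _; exact: esum_ge0.
rewrite -nneseries_esumT//; exact: (PG i).2.
Qed.

HB.instance Definition _ := isOuterMeasure.Build R 'rV[R]_n.+1 lebesgue_outer
  lebesgue_outer0 lebesgue_outer_ge0 le_lebesgue_outer
  lebesgue_outer_sigma_subadditive.

Definition lebesgue_rV : set (caratheodory_type lebesgue_outer) -> \bar R :=
  lebesgue_outer.

HB.instance Definition _ := isMeasure.Build _ _ R lebesgue_rV
  (@caratheodory_measure0 R _ lebesgue_outer)
  (@caratheodory_measure_ge0 R _ lebesgue_outer)
  (@caratheodory_measure_sigma_additive R _ lebesgue_outer).

End lebesgue_outer.

Arguments lebesgue_rV R n _ : clear implicits.

Section joint.
Context {R : realType} {n : nat}.
Implicit Types (f : 'rV[R]_n -> R) (D : set 'rV[R]_n) (a b c d x : 'rV[R]_n).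

Definition joint_increment f c d : R :=
  \sum_(e : {ffun 'I_n -> bool})
    (-1) ^+ (n + \sum_(i < n) e i) *
    f (\row_i (c ord0 i + (e i)%:R * (d ord0 i - c ord0 i))).

(* A function on [a, b] is represented by a total function; only its values on
   [a, b] matter. *)
Definition jointly_increasing f a b : Prop :=
  forall x y, vle a x -> vle x y -> vle y b -> 0 <= joint_increment f x y.

Definition joint_quotient f x (h : R) : R :=
  joint_increment f x (x + const_mx h) / h ^+ n.

(* D is the domain of f; D° is its interior. *)
Definition jointly_derivable f D x : Prop :=
  D° x /\ cvg (joint_quotient f x h @[h --> 0^'+]).

(* The value 0 where the joint derivative does not exist is a convention; for a
   jointly increasing f this happens on a null set only. *)
Definition joint_derivative f D x : R :=
  if `[< jointly_derivable f D x >]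
  then lim (joint_quotient f x h @[h --> 0^'+]) else 0.

End joint.

Definition jointly_absolutely_continuous (R : realType) (n : nat)
    (f : 'rV[R]_n.+1 -> R) (a b : 'rV[R]_n.+1) : Prop :=
  forall eps : R, 0 < eps -> exists2 delta : R, 0 < delta &
    forall (N : nat) (c d : 'I_N -> 'rV[R]_n.+1),
      (forall i, [/\ vle a (c i), vle (c i) (d i) & vle (d i) b]) ->
      (forall i j, i != j ->
        (box (c i) (d i))° `&` (box (c j) (d j))° = set0) ->
      (\sum_(i < N) lebesgue_rV R n (box (c i) (d i)) < delta%:E)%E ->
      \sum_(i < N) `|joint_increment f (c i) (d i)| < eps.

(* Main.v *)
From HB Require Import structures.
Require Import Defs.
From mathcomp Require Import all_boot all_order all_algebra.
From mathcomp Require Import all_classical all_reals all_analysis.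
From mathcomp Require Import measurable_realfun ring lra.

(** Write [d] for the dimension [n.+1] and [F I] for the joint increment of [f]
    over a rectangle [I]. The proof sees [f] only through [F], which is
    nonnegative on the subrectangles of [[a, b]] and additive when a rectangle
    is cut by a hyperplane parallel to an axis. Composing with the projection
    onto [[a, b]] (coordinatewise clamping) extends [F] to all rectangles and
    keeps these two properties.

    For every jointly increasing [f] and every subrectangle [I], the integral
    of the joint derivative over [I] is at most [F I]
    ([integral_joint_derivative_le]). By Fatou's lemma it is enough to bound the
    mean over [I] of [F [x, x + h] / h ^ d]. Replace the corner [x] by the
    lattice point below it, for a lattice of mesh [h / m]: the resulting cubes
    of [m + 1] cells per side cover each cell [(m + 1) ^ d] times, so that the
    mean is at most [(1 + 1 / m) ^ d * F I]. The upper bounds used here are step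
    functions, and the integral of a nonnegative function is a supremum over the
    simple functions below it, so the comparison is valid although the joint
    derivative and the difference quotients are not known to be measurable.

    Sufficiency. Let the integral of the joint derivative be [F [a, b]], and
    choose a measurable function [h] below the derivative with the same
    integral. Then [I |-> F I - \int_I h] is a nonnegative additive function of
    rectangles, hence monotone, and it vanishes on [[a, b]]; so it vanishes on
    every subrectangle ([increment_eq_integral]), and [f] is absolutely
    continuous because integrals are.

    Necessity. Let [f] be absolutely continuous. Coverings by rectangles,
    weighted by [F], define an outer measure for which Borel sets are
    measurable. Absolute continuity gives it the value [F I] on rectangles
    ([generated_box]) and makes Lebesgue null sets null ([generated_null]), so
    Radon-Nikodym provides a density [phi] of [F] ([density_exists]). It
    remains to see that the means of [phi] over the cubes [[x, x + h]] tend to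
    [phi x] almost everywhere ([differentiation]). This follows from the case of
    a function that vanishes on a set, at the points of this set
    ([zero_density]), applied to the part of [phi] above a rational level and
    to the indicator function of a sublevel set; that case is a Vitali covering
    argument. The joint derivative is then [phi] almost everywhere, and its
    integral is [F [a, b]]. *)

Set Implicit Arguments.
Unset Strict Implicit.
Unset Printing Implicit Defensive.

Import Order.TTheory GRing.Theory Num.Theory.
Import numFieldNormedType.Exports.

Local Open Scope classical_set_scope.
Local Open Scope ring_scope.

(** * Rectangles and additive functions of rectangles *)

(** [lra] treats [Num.max] and [Num.min] as atoms; the innermost tests are
    decided first, so that each case is linear. *)
Ltac lra_minmax := rewrite /Num.max /Num.min;
  repeat match goal with |- context [if ?x < ?y then _ else _] =>
    lazymatch x with context [if _ then _ else _] => fail | _ =>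
    lazymatch y with context [if _ then _ else _] => fail | _ =>
      case: (ltP x y) => ? end end end; lra.

Section coordinates.
Context {R : realType} {n : nat}.
Implicit Types (a b c d u v x y z : 'rV[R]_n) (i j : 'I_n) (s t : R).

Lemma vle_refl x : vle x x. Proof. by []. Qed.

Lemma vle_trans y x z : vle x y -> vle y z -> vle x z.
Proof. by move=> xy yz i; exact: le_trans (xy i) (yz i). Qed.

Definition upd x i t : 'rV[R]_n := \row_j (if j == i then t else x ord0 j).

Lemma updE x i t j : upd x i t ord0 j = if j == i then t else x ord0 j.
Proof. by rewrite mxE. Qed.

Lemma upd_id x i : upd x i (x ord0 i) = x.
Proof. by apply/rowP => j; rewrite updE; case: eqVneq => // ->. Qed.

Lemma upd_upd x i s t : upd (upd x i s) i t = upd x i t.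
Proof. by apply/rowP => j; rewrite !updE; case: eqVneq. Qed.

Lemma vle_upd x y i s t : vle x y -> s <= t -> vle (upd x i s) (upd y i t).
Proof. by move=> xy st j; rewrite !updE; case: eqVneq. Qed.

Lemma vle_updr x y i t : vle x y -> x ord0 i <= t -> vle x (upd y i t).
Proof. by move=> xy xt; rewrite -[X in vle X](upd_id x i); exact: vle_upd. Qed.

Lemma vle_updl x y i t : vle x y -> t <= y ord0 i -> vle (upd x i t) y.
Proof. by move=> xy ty; rewrite -[X in vle _ X](upd_id y i); exact: vle_upd. Qed.

(** Passing from [x] to [y] one coordinate at a time. *)
Lemma coord_ind (P : 'rV[R]_n -> Prop) x y : P x ->
  (forall z i, (forall j, z ord0 j = x ord0 j \/ z ord0 j = y ord0 j) ->
    P z -> P (upd z i (y ord0 i))) -> P y.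
Proof.
move=> Px step.
pose z k : 'rV[R]_n := \row_j (if (j < k)%N then y ord0 j else x ord0 j).
suff Pz k : (k <= n)%N -> P (z k).
  by rewrite (_ : y = z n)//; [exact: Pz | apply/rowP => j; rewrite mxE ltn_ord].
elim: k => [_|k ih kn]; first by rewrite (_ : z 0%N = x)//; apply/rowP => j; rewrite mxE.
have -> : z k.+1 = upd (z k) (Ordinal kn) (y ord0 (Ordinal kn)).
  apply/rowP => j; rewrite updE !mxE; case: eqVneq => [->|] /=.
    by rewrite ltnSn.
  by rewrite -val_eqE/= ltnS leq_eqVlt => /negbTE ->.
apply: step; last exact: ih (ltnW kn).
by move=> j; rewrite mxE; case: ifP; [right|left].
Qed.

Definition clamp c d x : 'rV[R]_n :=
  \row_j Num.max (c ord0 j) (Num.min (d ord0 j) (x ord0 j)).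

Lemma clampE c d x j :
  clamp c d x ord0 j = Num.max (c ord0 j) (Num.min (d ord0 j) (x ord0 j)).
Proof. by rewrite mxE. Qed.

Lemma le_clamp c d x y i : x ord0 i <= y ord0 i ->
  clamp c d x ord0 i <= clamp c d y ord0 i.
Proof. by rewrite !clampE; lra_minmax. Qed.

Lemma vle_clamp c d x y : vle x y -> vle (clamp c d x) (clamp c d y).
Proof. by move=> xy i; exact: le_clamp. Qed.

Lemma clamp_ge c d x : vle c (clamp c d x).
Proof. by move=> i; rewrite clampE le_max lexx. Qed.

Lemma clamp_le c d x : vle c d -> vle (clamp c d x) d.
Proof. by move=> cd i; rewrite clampE ge_max cd ge_min lexx. Qed.

Lemma clamp_id c d x : vle c x -> vle x d -> clamp c d x = x.
Proof.
by move=> cx xd; apply/rowP => i; rewrite clampE; have := cx i; have := xd i; lra_minmax.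
Qed.

Lemma clamp_width c d x y i : vle x y ->
  clamp c d y ord0 i - clamp c d x ord0 i <= y ord0 i - x ord0 i.
Proof. by move=> /(_ i); rewrite !clampE; lra_minmax. Qed.

Lemma clamp_upd c d x i t : clamp c d (upd x i t) =
  upd (clamp c d x) i (Num.max (c ord0 i) (Num.min (d ord0 i) t)).
Proof. by apply/rowP => j; rewrite !(clampE, updE); case: eqVneq => // ->. Qed.

End coordinates.

Section additive.
Context {R : realType} {n : nat}.
Implicit Types (a b c d u v x y z : 'rV[R]_n) (i j : 'I_n) (s t : R).
Implicit Types V : 'rV[R]_n -> 'rV[R]_n -> R.

Definition box_additive_on a b V :=
  (forall x y, vle a x -> vle x y -> vle y b -> 0 <= V x y) /\
  (forall x y i t, vle a x -> vle x y -> vle y b ->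
    x ord0 i <= t <= y ord0 i ->
    V x y = V x (upd y i t) + V (upd x i t) y).

(** Additivity is only required of ordered corners: for an indefinite integral
    the other ones have no meaning. *)
Definition box_additive V :=
  (forall x y, vle x y -> 0 <= V x y) /\
  (forall x y i t, vle x y -> x ord0 i <= t <= y ord0 i ->
    V x y = V x (upd y i t) + V (upd x i t) y).

Definition clamped c d V x y := V (clamp c d x) (clamp c d y).

Lemma additive_clamped a b V : vle a b -> box_additive_on a b V ->
  box_additive (clamped a b V).
Proof.
move=> ab [V0 VD]; split=> [x y xy|x y i t xy xty].
  by apply: V0; [exact: clamp_ge|exact: vle_clamp|exact: clamp_le].
rewrite /clamped !clamp_upd; apply: VD; [exact: clamp_ge|exact: vle_clamp|exact: clamp_le|].
by rewrite !clampE; move/andP: xty => [? ?]; apply/andP; split; lra_minmax.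
Qed.

Lemma additive_additive_on a b V : box_additive V -> box_additive_on a b V.
Proof.
move=> [V0 VD]; split=> [x y _ xy _|x y i t _ xy _]; [exact: V0|exact: VD].
Qed.

Section fixed.
Variable V : 'rV[R]_n -> 'rV[R]_n -> R.
Hypothesis addV : box_additive V.
Let V0 := addV.1.
Let VD := addV.2.

Lemma additive_degenerate x y i : vle x y -> x ord0 i = y ord0 i -> V x y = 0.
Proof.
move=> xy xyi; have := @VD x y i (y ord0 i) xy; rewrite xyi lexx => /(_ isT).
rewrite upd_id -[upd x i _](_ : x = _); first lra.
by rewrite -xyi upd_id.
Qed.

(** The form of additivity without a condition on the position of [t]: when the
    hyperplane misses the rectangle, one of the two pieces is degenerate. *)
Lemma additive_split x y i t : vle x y -> V x y =
  V (upd x i (Num.min t (x ord0 i))) (upd y i (Num.min t (y ord0 i))) +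
  V (upd x i (Num.max t (x ord0 i))) (upd y i (Num.max t (y ord0 i))).
Proof.
move=> xy; have xyi := xy i.
have V00 : V (upd x i t) (upd y i t) = 0.
  by apply: (@additive_degenerate _ _ i); [exact: vle_upd|rewrite !updE eqxx].
have [tx|xt] := leP t (x ord0 i).
  rewrite (min_idPl (le_trans tx xyi)) (max_idPr (le_trans tx xyi)) !upd_id.
  by rewrite V00 add0r.
have [ty|yt] := leP t (y ord0 i).
  by rewrite !upd_id; apply: VD; rewrite // (ltW xt) ty.
by rewrite !upd_id V00 addr0.
Qed.

(** Clamping intersects a fixed rectangle with [[c, d]], as long as they meet;
    otherwise it gives a degenerate rectangle, on which [V] vanishes. So additivity
    can also be read in the window [[c, d]]. *)
Lemma additive_clamped_cut c d x y i t : vle c d ->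
  c ord0 i <= t <= d ord0 i -> vle x y ->
  clamped c d V x y =
  clamped c (upd d i t) V x y + clamped (upd c i t) d V x y.
Proof.
move=> cd /andP[ct td] xy.
rewrite /clamped (@additive_split _ _ i t (vle_clamp c d xy)).
have E1 w : upd (clamp c d w) i (Num.min t (clamp c d w ord0 i)) =
    clamp c (upd d i t) w.
  apply/rowP => j; rewrite !(updE, clampE); case: eqVneq => // ->; lra_minmax.
have E2 w : upd (clamp c d w) i (Num.max t (clamp c d w ord0 i)) =
    clamp (upd c i t) d w.
  apply/rowP => j; rewrite !(updE, clampE); case: eqVneq => // ->; lra_minmax.
by rewrite !E1 !E2.
Qed.

(** Moving one face inwards cuts off a rectangle of nonnegative weight. *)
Lemma additive_mono x' x y y' : vle x' x -> vle x y -> vle y y' ->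
  V x y <= V x' y'.
Proof.
move=> xx xy yy.
have x'y := vle_trans xx xy.
apply: (@le_trans _ _ (V x' y)).
  suff [] : V x y <= V x' y /\ vle x y by [].
  apply: (@coord_ind _ _ (fun z => V z y <= V x' y /\ vle z y) x' x) => //.
  move=> z i zE [le1 zy].
  have zx : z ord0 i <= x ord0 i by case: (zE i) => ->.
  have z'y : vle (upd z i (x ord0 i)) y by apply: vle_updl => //; exact: xy.
  split => //; apply: le_trans le1.
  rewrite (@VD z y i (x ord0 i))// ?zx ?xy// lerDr V0//.
  exact: vle_updr.
suff [] : V x' y <= V x' y' /\ vle x' y by [].
apply: (@coord_ind _ _ (fun z => V x' z <= V x' y' /\ vle x' z) y' y).
  by split => //; exact: vle_trans yy.
move=> z i zE [le1 zy].
have zx : y ord0 i <= z ord0 i by case: (zE i) => ->.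
split; last exact: vle_updr.
apply: le_trans le1.
rewrite (@VD x' z i (y ord0 i))// ?zx ?x'y// lerDl V0//.
exact: vle_updl.
Qed.

End fixed.

Lemma joint_increment_cut (f : 'rV[R]_n -> R) x y i t :
  joint_increment f x y =
  joint_increment f x (upd y i t) + joint_increment f (upd x i t) y.
Proof.
(* the vertices of the rectangle with corners u and v *)
pose vert u v (e : {ffun 'I_n -> bool}) : 'rV[R]_n :=
  \row_j (if e j then v ord0 j else u ord0 j).
have jE u v : joint_increment f u v = \sum_(e : {ffun 'I_n -> bool})
    (-1) ^+ (n + \sum_(i < n) e i) * f (vert u v e).
  apply: eq_bigr => e _; congr (_ * f _); apply/rowP => j; rewrite !mxE.
  by case: (e j) => /=; lra.
rewrite !jE (bigID (fun e : {ffun 'I_n -> bool} => e i))/=.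
rewrite [in RHS](bigID (fun e : {ffun 'I_n -> bool} => e i))/=.
rewrite [X in _ = _ + X](bigID (fun e : {ffun 'I_n -> bool} => e i))/=.
set A1 := (X in X + _ = _); set A0 := (X in _ + X = _).
set C1 := (X in _ = (X + _) + _); set B0 := (X in _ = (_ + X) + _).
set B1 := (X in _ = _ + (X + _)); set C0 := (X in _ = _ + (_ + X)).
have -> : B0 = A0.
  apply: eq_bigr => e /negbTE ei; congr (_ * f _); apply/rowP => j.
  by rewrite !mxE; case: eqVneq => // ->; rewrite ei.
have -> : B1 = A1.
  apply: eq_bigr => e ei; congr (_ * f _); apply/rowP => j.
  by rewrite !mxE; case: eqVneq => // ->; rewrite ei.
(* the vertices on the cutting hyperplane occur twice, with opposite signs *)
suff -> : C0 = - C1 by rewrite [A1 - C1]addrC addrACA subrr add0r addrC.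
pose fl (e : {ffun 'I_n -> bool}) := [ffun j => if j == i then ~~ e j else e j].
have flK : involutive fl.
  by move=> e; apply/ffunP => j; rewrite !ffunE; case: eqVneq => // _; rewrite negbK.
rewrite /C0 /C1 (reindex_inj (inv_inj flK))/= -sumrN; apply: eq_big => e.
  by rewrite ffunE eqxx negbK.
move=> ei; rewrite ffunE eqxx negbK in ei.
rewrite -mulNr; congr (_ * f _).
  rewrite !exprD -mulrN; congr (_ * _).
  rewrite (bigD1 i)//= ffunE eqxx ei add0n [in RHS](bigD1 i)//= ei exprD expr1 mulN1r opprK.
  by congr (_ ^+ _); apply: eq_bigr => j ji; rewrite ffunE (negbTE ji).
apply/rowP => j; rewrite !mxE !ffunE; case: eqVneq => [->|//].
by rewrite ei.
Qed.

Lemma box_volume_cut x y i t :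
  box_volume x y = box_volume x (upd y i t) + box_volume (upd x i t) y.
Proof.
rewrite /box_volume (bigD1 i)//= [X in _ = X + _](bigD1 i)//=.
rewrite [X in _ = _ + X](bigD1 i)//= !updE eqxx.
rewrite [X in _ = _ * X + _](_ : _ = \prod_(j < n | j != i) (y ord0 j - x ord0 j)); last first.
  by apply: eq_bigr => j /negbTE ji; rewrite updE ji.
rewrite [X in _ = _ + _ * X](_ : _ = \prod_(j < n | j != i) (y ord0 j - x ord0 j)); last first.
  by apply: eq_bigr => j /negbTE ji; rewrite updE ji.
by ring.
Qed.

Lemma additive_box_volume : box_additive box_volume.
Proof.
split=> [x y xy|x y i t _ _]; last exact: box_volume_cut.
by apply: prodr_ge0 => i _; rewrite subr_ge0; exact: xy.
Qed.

Lemma additive_joint_increment f a b : jointly_increasing f a b ->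
  box_additive_on a b (joint_increment f).
Proof. by move=> fab; split=> // x y i t _ _ _ _; exact: joint_increment_cut. Qed.

(** Cousin's lemma, by repeated bisection: a property that passes from the two
    halves of a rectangle to the whole, and that holds for all small rectangles
    around each point, holds globally. It takes the place of compactness and,
    unlike a finite subcover, needs no bookkeeping of overlaps. *)
Lemma box_induction (P : 'rV[R]_n -> 'rV[R]_n -> Prop) c d : vle c d ->
  (forall x y i t, vle c x -> vle x y -> vle y d -> x ord0 i <= t <= y ord0 i ->
    P x (upd y i t) -> P (upd x i t) y -> P x y) ->
  (forall z, vle c z -> vle z d -> exists2 e : R, 0 < e &
    forall x y, vle c x -> vle x z -> vle z y -> vle y d ->
      (forall i, y ord0 i - x ord0 i < e) -> P x y) ->
  P c d.
Proof.
move=> cd cut local; apply: contrapT => nP.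
pose Q (p : 'rV[R]_n * 'rV[R]_n) :=
  [/\ vle c p.1, vle p.1 p.2, vle p.2 d & ~ P p.1 p.2].
have step p : Q p -> exists q, [/\ Q q, vle p.1 q.1, vle q.2 p.2 &
    forall i, q.2 ord0 i - q.1 ord0 i = (p.2 ord0 i - p.1 ord0 i) / 2].
  case: p => x y Qxy.
  (* halving the first k sides *)
  suff H k : (k <= n)%N -> exists q, [/\ Q q, vle x q.1, vle q.2 y &
    forall i, q.2 ord0 i - q.1 ord0 i =
      if (i < k)%N then (y ord0 i - x ord0 i) / 2 else y ord0 i - x ord0 i].
    have [q [Qq xq qy qE]] := H n (leqnn n).
    by exists q; split => // i; rewrite qE ltn_ord.
  elim: k => [_|k ih kn]; first by exists (x, y); split.
  have [[u v]/= [[/= cu uv vd nPuv] xu vy uvE]] := ih (ltnW kn).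
  set i := Ordinal kn; pose t := (u ord0 i + v ord0 i) / 2.
  have ui : u ord0 i <= t by have := uv i; rewrite /t; lra.
  have iv : t <= v ord0 i by have := uv i; rewrite /t; lra.
  have uvi : v ord0 i - u ord0 i = y ord0 i - x ord0 i by rewrite uvE/= ltnn.
  have sides (j : 'I_n) : (if (j < k.+1)%N then (y ord0 j - x ord0 j) / 2
      else y ord0 j - x ord0 j) = if j == i then (v ord0 j - u ord0 j) / 2
      else v ord0 j - u ord0 j.
    case: eqVneq => [->|]; first by rewrite /= ltnSn uvi.
    by rewrite -val_eqE/= ltnS leq_eqVlt => /negbTE ->; rewrite uvE.
  have [Pl|nPl] := pselect (P u (upd v i t)); last first.
    exists (u, upd v i t); split => //=.
    - split => //=; first exact: vle_updr.
      by apply: vle_updl => //; exact: le_trans (vd i).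
    - by apply: vle_updl => //; exact: le_trans (vy i).
    - move=> j; rewrite sides updE; case: eqVneq => // ->; rewrite /t; lra.
  exists (upd u i t, v); split => //=.
  - split => //=; first by apply: vle_updr => //; exact: le_trans ui.
    + exact: vle_updl.
    + by move=> Pr; apply: nPuv; apply: cut Pl Pr => //; rewrite ui iv.
  - by apply: vle_updr => //; exact: le_trans ui.
  - move=> j; rewrite sides updE; case: eqVneq => // ->; rewrite /t; lra.
have [g gP] := choice (fun p : {p | Q p} => step (sval p) (svalP p)).
have [h hP] : {h : {p | Q p} -> {p | Q p} & forall p,
    [/\ vle (sval p).1 (sval (h p)).1, vle (sval (h p)).2 (sval p).2 &
    forall i, (sval (h p)).2 ord0 i - (sval (h p)).1 ord0 i =
      ((sval p).2 ord0 i - (sval p).1 ord0 i) / 2]}.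
  have Qg p : Q (g p) by have [] := gP p.
  by exists (fun p => exist _ (g p) (Qg p)) => p /=; have [] := gP p.
have Q0 : Q (c, d) by split.
pose s k := sval (iter k h (exist _ (c, d) Q0)).
have sQ k : Q (s k) by exact: svalP.
have s1 k l : vle (s k).1 (s (k + l)%N).1.
  elim: l => [|l ih]; first by rewrite addn0.
  by rewrite addnS; apply: vle_trans ih _; have [] := hP (iter (k + l) h (exist _ (c, d) Q0)).
have s2 k l : vle (s (k + l)%N).2 (s k).2.
  elim: l => [|l ih]; first by rewrite addn0.
  by rewrite addnS; apply: vle_trans ih; have [] := hP (iter (k + l) h (exist _ (c, d) Q0)).
have s12 k l : vle (s k).1 (s l).2.
  apply: vle_trans (s1 k l) _; apply: (@vle_trans _ _ (s (k + l)%N).2).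
    by have [] := sQ (k + l)%N.
  by rewrite addnC; exact: s2.
have sside k i : (s k).2 ord0 i - (s k).1 ord0 i = (d ord0 i - c ord0 i) / 2 ^+ k.
  elim: k => [|k ih]; first by rewrite expr0 divr1.
  have [_ _ /(_ i)] := hP (iter k h (exist _ (c, d) Q0)).
  rewrite -/(s k) => E; rewrite [LHS]E ih exprSr invfM mulrA //.
pose z : 'rV[R]_n := \row_i sup (range (fun k => (s k).1 ord0 i)).
have hs i : has_sup (range (fun k => (s k).1 ord0 i)).
  split; first by exists ((s 0%N).1 ord0 i); exists 0%N.
  by exists ((s 0%N).2 ord0 i) => _ [k _ <-]; exact: s12.
have sz k : vle (s k).1 z.
  by move=> i; rewrite mxE; apply: ub_le_sup; [exact: (hs i).2|exists k].
have zs k : vle z (s k).2.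
  by move=> i; rewrite mxE; apply: ge_sup; [exact: (hs i).1|move=> _ [l _ <-]; exact: s12].
have [e e0 He] := local z (sz 0%N) (zs 0%N).
have [k kP] : exists k, forall i, (d ord0 i - c ord0 i) / 2 ^+ k < e.
  pose M := \sum_i (d ord0 i - c ord0 i).
  have dM i : d ord0 i - c ord0 i <= M.
    rewrite /M (bigD1 i)//= lerDl; apply: sumr_ge0 => j _.
    by rewrite subr_ge0.
  exists (Num.bound (M / e)) => i.
  rewrite ltr_pdivrMr ?exprn_gt0// (le_lt_trans (dM i))// -ltr_pdivrMl// mulrC.
  have [M0|M0] := leP 0 M.
    apply: lt_trans (archi_boundP _) _; first by rewrite divr_ge0// ltW.
    by rewrite -natrX ltr_nat ltn_expl.
  apply: (@lt_trans _ _ 0); last exact: exprn_gt0.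
  by rewrite pmulr_llt0// invr_gt0.
have [_ _ _ ] := sQ k; apply; apply: He => //; first by have [] := sQ k.
  by have [] := sQ k.
by move=> i; rewrite sside.
Qed.

End additive.

(** * Decomposition along a lattice *)

Section grid.
Context {R : realType} {n : nat}.
Variable V : 'rV[R]_n -> 'rV[R]_n -> R.
Hypothesis addV : box_additive V.

Lemma additive_telescope x y i (t : nat -> R) K : vle x y ->
  {homo t : k l / (k <= l)%N >-> k <= l} ->
  V (upd x i (t 0%N)) (upd y i (t K)) =
  \sum_(k < K) V (upd x i (t k)) (upd y i (t k.+1)).
Proof.
move=> xy tle; elim: K => [|K ih].
  rewrite big_ord0. apply: (@additive_degenerate _ _ _ addV _ _ i).
    exact: vle_upd.
  by rewrite !updE eqxx.
rewrite big_ord_recr/= -ih (addV.2 _ _ i (t K)) ?upd_upd//.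
  by apply: vle_upd => //; exact: tle.
by rewrite !updE eqxx !tle.
Qed.

(** Refining one coordinate at a time changes the sum over all cells by a
    factor [K]: a cell of the coarser subdivision is repeated for each value of
    the index of the coordinate that is not subdivided yet. Summing over all index
    functions throughout avoids a sum whose index type changes with the step. *)
Lemma additive_grid (t : 'I_n -> nat -> R) K : (0 < K)%N ->
  (forall i, {homo t i : k l / (k <= l)%N >-> k <= l}) ->
  \sum_(p : {ffun 'I_n -> 'I_K}) V (\row_i t i (p i)) (\row_i t i (p i).+1) =
  V (\row_i t i 0%N) (\row_i t i K).
Proof.
move=> K0 tle.
pose lo m (p : {ffun 'I_n -> 'I_K}) : 'rV[R]_n :=
  \row_j (if (j < m)%N then t j (p j) else t j 0%N).
pose hi m (p : {ffun 'I_n -> 'I_K}) : 'rV[R]_n :=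
  \row_j (if (j < m)%N then t j (p j).+1 else t j K).
have lohi m p : vle (lo m p) (hi m p).
  by move=> j; rewrite !mxE; case: ifP => _; apply: tle.
pose set_ (p : {ffun 'I_n -> 'I_K}) (i : 'I_n) (k : 'I_K) : {ffun 'I_n -> 'I_K} :=
  [ffun j => if j == i then k else p j].
have step m : (m < n)%N ->
    \sum_p V (lo m p) (hi m p) = K%:R * \sum_p V (lo m.+1 p) (hi m.+1 p).
  move=> mn; set i := Ordinal mn.
  have E p : V (lo m p) (hi m p) =
      \sum_(k < K) V (lo m.+1 (set_ p i k)) (hi m.+1 (set_ p i k)).
    have -> : lo m p = upd (lo m p) i (t i 0%N).
      by apply/rowP => j; rewrite !mxE; case: eqVneq => // ->; rewrite ltnn.
    have -> : hi m p = upd (hi m p) i (t i K).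
      by apply/rowP => j; rewrite !mxE; case: eqVneq => // ->; rewrite ltnn.
    rewrite additive_telescope//; apply: eq_bigr => k _.
    have ltm (j : 'I_n) : j != i -> (j < m.+1)%N = (j < m)%N.
      by rewrite -val_eqE/= ltnS leq_eqVlt => /negbTE ->.
    by congr V; apply/rowP => j; rewrite !(mxE, ffunE);
      case: (eqVneq j i) => [->|/ltm ->]//; rewrite /= ltnSn.
  rewrite (eq_bigr _ (fun p _ => E p)) pair_big/=.
  (* exchanging the new index with the one it replaces is an involution *)
  pose sg (q : {ffun 'I_n -> 'I_K} * 'I_K) := (set_ q.1 i q.2, q.1 i).
  have sgK : involutive sg.
    move=> [p k]; rewrite /sg/= ffunE eqxx; congr (_, _).
    by apply/ffunP => j; rewrite !ffunE; case: eqVneq => // ->.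
  rewrite (reindex_inj (inv_inj sgK))/=.
  rewrite (eq_bigr (fun q => V (lo m.+1 q.1) (hi m.+1 q.1))); last first.
    by move=> q _; have := sgK q; case: q => p k [-> _].
  rewrite -(pair_big xpredT xpredT (fun p (_ : 'I_K) => V (lo m.+1 p) (hi m.+1 p)))/=.
  rewrite mulr_sumr; apply: eq_bigr => p _.
  by rewrite sumr_const card_ord mulr_natl.
have all m : (m <= n)%N -> \sum_p V (lo 0%N p) (hi 0%N p) =
    K%:R ^+ m * \sum_p V (lo m p) (hi m p).
  elim: m => [_|m ih mn]; first by rewrite expr0 mul1r.
  by rewrite ih ?(ltnW mn)// step// mulrA exprSr.
have Kn0 : K%:R ^+ n != 0 :> R by rewrite expf_neq0// pnatr_eq0 -lt0n.
apply: (mulfI Kn0).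
transitivity (\sum_p V (lo 0%N p) (hi 0%N p)).
  rewrite (all n)//; congr (_ * _); apply: eq_bigr => p _.
  by congr V; apply/rowP => j; rewrite !mxE ltn_ord.
rewrite (eq_bigr (fun=> V (\row_i t i 0%N) (\row_i t i K))).
  by rewrite sumr_const card_ffun !card_ord -natrX mulr_natl.
by move=> p _; congr V; apply/rowP => j; rewrite !mxE.
Qed.

End grid.

(** * Outer measures generated by an additive function of rectangles *)

Lemma fin_lower (R : realType) (I : finType) (g : I -> R) :
  (forall i, 0 < g i) -> exists2 e : R, 0 < e & forall i, e <= g i.
Proof.
move=> g0; exists (\big[Num.min/1]_i g i); last by move=> i; exact: bigmin_le.
by apply: lt_bigmin.
Qed.

Lemma lattice_cell (R : realType) (c eta x : R) (M : nat) : 0 < eta ->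
  c <= x -> x < c + eta * M%:R ->
  exists p : 'I_M, c + eta * p%:R <= x <= c + eta * p.+1%:R.
Proof.
move=> eta0 cx xM; pose y := (x - c) / eta.
have y0 : 0 <= y by rewrite divr_ge0 ?(ltW eta0)// subr_ge0.
have /andP[t1 t2] := truncn_itv y0.
have tM : (Num.truncn y < M)%N.
  rewrite -(ltr_nat R); apply: le_lt_trans t1 _.
  by rewrite /y ltr_pdivrMr// mulrC; lra.
exists (Ordinal tM) => /=.
move: t1 t2; rewrite /y ler_pdivlMr// ltr_pdivrMr// => t1 t2.
by rewrite [eta * _]mulrC [eta * _]mulrC; apply/andP; split; lra.
Qed.

Section outer_box.
Context {R : realType} {n : nat}.
Notation T := 'rV[R]_n.+1.
Implicit Types (c d x y : T).

Definition obox c d : set T :=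
  [set x | forall i, c ord0 i < x ord0 i < d ord0 i].

Lemma obox_box c d : obox c d `<=` box c d.
Proof. by move=> x cxd; split=> i; have /andP[/ltW ? /ltW] := cxd i. Qed.

Section cover.
Variable V : T -> T -> R.
Hypothesis addV : box_additive V.

Lemma additive_clampedl x y : vle x y ->
  box_additive (fun c d => clamped c d V x y).
Proof.
move=> xy; split=> [c d cd|c d i t cd ct].
  by rewrite /clamped; apply: addV.1; exact: vle_clamp.
exact: additive_clamped_cut.
Qed.

Lemma clamped_ge0 c d x y : vle x y -> 0 <= clamped c d V x y.
Proof. by move=> xy; apply: addV.1; exact: vle_clamp. Qed.

(** The left-hand side is additive, hence monotone, in the window [[c, d]], and
    it equals [V x y] for a window that contains [[x, y]]. *)
Lemma clamped_le c d x y : vle c d -> vle x y -> clamped c d V x y <= V x y.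
Proof.
move=> cd xy.
pose c' : T := \row_i Num.min (c ord0 i) (x ord0 i).
pose d' : T := \row_i Num.max (d ord0 i) (y ord0 i).
have -> : V x y = clamped c' d' V x y.
  by rewrite /clamped; congr V; rewrite clamp_id// => i; rewrite mxE;
    have := xy i; rewrite ?ge_min ?le_max ?lexx ?orbT//;
    move=> ->; rewrite orbT.
apply: (additive_mono (additive_clampedl xy)) => // i; rewrite mxE.
  by rewrite ge_min lexx.
by rewrite le_max lexx.
Qed.

Lemma clamped_sub c d x y : vle x c -> vle d y -> vle c d ->
  clamped c d V x y = V c d.
Proof.
move=> xc dy cd; rewrite /clamped; congr V; apply/rowP => i; rewrite clampE.
  by have := xc i; have := cd i; lra_minmax.
by have := dy i; have := cd i; lra_minmax.
Qed.

(** Countable subadditivity over coverings by open rectangles. The inequality,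
    with all rectangles intersected with a window, is additive in the window, and
    in a small window one covering rectangle is already enough. *)
Lemma additive_cover c d (B : nat -> T * T) : vle c d ->
  (forall k, vle (B k).1 (B k).2) ->
  box c d `<=` \bigcup_k obox (B k).1 (B k).2 ->
  ((V c d)%:E <= \sum_(k <oo) (V (B k).1 (B k).2)%:E)%E.
Proof.
move=> cd leB cdB.
pose P x y := ((V x y)%:E <=
  \sum_(k <oo) (clamped x y V (B k).1 (B k).2)%:E)%E.
suff Pcd : P c d.
  apply: le_trans Pcd _; apply: lee_nneseries => [k _|k] _.
    by rewrite lee_fin; exact: clamped_ge0.
  by rewrite lee_fin clamped_le.
apply: (@box_induction _ _ P) => //; rewrite -/P.
- move=> x y i t cx xy yd xty P1 P2; rewrite /P (addV.2 _ _ i t)//.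
  rewrite EFinD; apply: le_trans (leeD P1 P2) _.
  rewrite -nneseriesD.
  + apply: lee_nneseries => [k _|k] _.
      by apply: adde_ge0; rewrite lee_fin; exact: clamped_ge0.
    by rewrite -EFinD lee_fin [leRHS](additive_clamped_cut addV (i := i) (t := t)).
  + move=> k _ _; rewrite lee_fin; exact: clamped_ge0.
  + move=> k _ _; rewrite lee_fin; exact: clamped_ge0.
move=> z cz zd.
have [k _ Bkz] := cdB z (conj cz zd).
have [e e0 He] := @fin_lower R 'I_n.+1
  (fun i => Num.min (z ord0 i - (B k).1 ord0 i) ((B k).2 ord0 i - z ord0 i)) ltac:(
    by move=> i; have /andP[? ?] := Bkz i; rewrite lt_min !subr_gt0; apply/andP).
exists e => // x y cx xz zy yd xye.
have xy := vle_trans xz zy.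
have Vk : V x y = clamped x y V (B k).1 (B k).2.
  rewrite clamped_sub// => i; have := He i; have := xye i; have := xz i;
  have := zy i; rewrite le_min => ? ? ? /andP[? ?]; lra.
rewrite /P {1}Vk.
apply: le_trans (nneseries_lim_ge k.+1 _).
  rewrite big_mkord big_ord_recr/= leeDr//; apply: sume_ge0 => j _.
  by rewrite lee_fin; exact: clamped_ge0.
by move=> j _ _; rewrite lee_fin; exact: clamped_ge0.
Qed.

End cover.

(** [mu] is the outer measure that Caratheodory's construction attaches to [V]:
    the infimum of the total weight over countable coverings by rectangles. This
    covers Lebesgue outer measure and the one attached to an increment. *)
Definition generated (mu : set T -> \bar R) (V : T -> T -> R) :=
  (forall c d, vle c d -> mu (box c d) <= (V c d)%:E)%E /\
  (forall X r, (mu X < r)%E -> exists2 B, box_cover X B &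
     (\sum_(k <oo) (V (B k).1 (B k).2)%:E < r)%E).

(** Absolute continuity with respect to volume, for one rectangle at a time and
    within a bounded region: it makes thin slabs light, which is what allows
    covering rectangles to be enlarged. *)
Definition vol_continuous V := forall (a b : T) (e : R), 0 < e ->
  exists2 del : R, 0 < del & forall x y : T, vle a x -> vle x y -> vle y b ->
    box_volume x y < del -> V x y <= e.

Section generated.
Variables (mu : {outer_measure set T -> \bar R}) (V : T -> T -> R).
Hypotheses (addV : box_additive V) (muV : generated mu V).

Lemma generated_cover X B : box_cover X B ->
  (mu X <= \sum_(k <oo) (V (B k).1 (B k).2)%:E)%E.
Proof.
move=> [leB XB]; apply: le_trans (le_outer_measure mu _ _ XB) _.
apply: le_trans (outer_measure_sigma_subadditive mu _) _.
apply: lee_nneseries => [k _ _|k _]; first exact: outer_measure_ge0.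
exact: muV.1.
Qed.

(** Cut each rectangle of a covering of [X] along the hyperplane: the lower
    pieces cover [X `&` A], the upper ones [X `&` ~` A], and the total weight is
    unchanged. The hyperplane itself may belong to either side. *)
Lemma halfspace_caratheodory A i t :
  A `<=` [set x : T | x ord0 i <= t] -> ~` A `<=` [set x : T | t <= x ord0 i] ->
  mu.-caratheodory A.
Proof.
move=> At tA; apply: le_caratheodory_measurable => X.
apply/lee_addgt0Pr => e e0.
have [Xoo|Xfin] := eqVneq (mu X) +oo%E; first by rewrite Xoo leey.
have Xf : mu X \is a fin_num.
  by rewrite ge0_fin_numE ?outer_measure_ge0// ltey.
have [|B [leB XB] BX] := muV.2 X (mu X + e%:E)%E.
  by rewrite lteDl ?lte_fin.
apply: le_trans (ltW BX).
pose lo x := upd x i (Num.min t (x ord0 i)).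
pose hi x := upd x i (Num.max t (x ord0 i)).
have lole x y : vle x y -> vle (lo x) (lo y).
  by move=> xy; apply: vle_upd => //; have := xy i; lra_minmax.
have hile x y : vle x y -> vle (hi x) (hi y).
  by move=> xy; apply: vle_upd => //; have := xy i; lra_minmax.
have c1 : box_cover (X `&` A) (fun k => (lo (B k).1, lo (B k).2)).
  split=> [k /=|x [Xx Ax]]; first exact: lole.
  have [k _ [Bx xB]] := XB x Xx; exists k => //=; have xt := At x Ax.
  by split=> j; rewrite updE; case: eqVneq => // ->; have := Bx i; have := xB i;
    move: xt => /=; lra_minmax.
have c2 : box_cover (X `&` ~` A) (fun k => (hi (B k).1, hi (B k).2)).
  split=> [k /=|x [Xx Ax]]; first exact: hile.
  have [k _ [Bx xB]] := XB x Xx; exists k => //=; have xt := tA x Ax.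
  by split=> j; rewrite updE; case: eqVneq => // ->; have := Bx i; have := xB i;
    move: xt => /=; lra_minmax.
apply: le_trans (leeD (generated_cover c1) (generated_cover c2)) _.
rewrite -nneseriesD/=; last 2 first.
  by move=> k _ _; rewrite lee_fin; apply: addV.1; exact: lole.
  by move=> k _ _; rewrite lee_fin; apply: addV.1; exact: hile.
apply: lee_nneseries => [k _ _|k _].
  by apply: adde_ge0; rewrite lee_fin; apply: addV.1; [exact: lole|exact: hile].
by rewrite -EFinD lee_fin [leRHS](additive_split addV i t).
Qed.

(** An enlarged rectangle consists of the original one and [2 * n.+1] slabs of
    thickness [eta], each of volume at most [eta * M ^ n]. *)
Lemma expand_box x y e : vol_continuous V -> vle x y -> 0 < e ->
  exists2 eta : R, 0 < eta & V (x - const_mx eta) (y + const_mx eta) <= V x y + e.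
Proof.
move=> acV xy e0.
pose N : R := n.+1%:R.
have N0 : 0 < N by rewrite ltr0n.
pose a := x - const_mx 1; pose b := y + const_mx 1.
have [del del0 Hdel] := acV a b (e / (2 * N)) ltac:(by rewrite divr_gt0// mulr_gt0).
pose M := 1 + \sum_i (b ord0 i - a ord0 i).
have ab i : a ord0 i <= b ord0 i by rewrite !mxE; have := xy i; lra.
have abM i : b ord0 i - a ord0 i <= M.
  rewrite /M (bigD1 i)//=; suff : 0 <= \sum_(j | j != i) (b ord0 j - a ord0 j) by lra.
  by apply: sumr_ge0 => j _; have := ab j; lra.
have M0 : 0 < M.
  by rewrite /M ltr_pwDl// sumr_ge0// => j _; have := ab j; lra.
have slab u v i s : vle a u -> vle u v -> vle v b -> v ord0 i - u ord0 i <= s ->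
    s * M ^+ n < del -> V u v <= e / (2 * N).
  move=> au uv vb uvs sM; apply: Hdel => //; apply: le_lt_trans sM.
  rewrite /box_volume (bigD1 i)//=; apply: ler_pM => //.
  - by have := uv i; lra.
  - by apply: prodr_ge0 => j _; have := uv j; lra.
  - apply: le_trans (_ : \prod_(j < n.+1 | j != i) M <= _).
      apply: ler_prod => j _; rewrite subr_ge0 uv/=; apply: le_trans (abM j).
      by have := au j; have := vb j; lra.
    by rewrite prodr_const cardC1 card_ord.
pose eta := Num.min 1 (del / (2 * M ^+ n)).
have Mn : 0 < M ^+ n by exact: exprn_gt0.
have eta0 : 0 < eta by rewrite lt_min ltr01 divr_gt0// mulr_gt0.
have eta1 : eta <= 1 by rewrite ge_min lexx.
have etaM : eta * M ^+ n < del.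
  apply: (@le_lt_trans _ _ (del / 2)); last by lra.
  rewrite -ler_pdivlMr//; apply: le_trans (_ : del / (2 * M ^+ n) <= _).
    by rewrite ge_min lexx orbT.
  by rewrite invfM mulrA.
exists eta => //.
pose lo k : T := \row_j (if (j < k)%N then x ord0 j - eta else x ord0 j).
pose hi k : T := \row_j (if (j < k)%N then y ord0 j + eta else y ord0 j).
have alo k : vle a (lo k) by move=> j; rewrite !mxE; case: ifP => _; lra.
have hib k : vle (hi k) b by move=> j; rewrite !mxE; case: ifP => _; lra.
have lohi k : vle (lo k) (hi k).
  by move=> j; rewrite !mxE; case: ifP => _; have := xy j; lra.
suff H k : (k <= n.+1)%N -> V (lo k) (hi k) <= V x y + k%:R * (e / N).
  have := H n.+1 (leqnn _); rewrite -/N mulrCA divff ?gt_eqF// mulr1.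
  congr (V _ _ <= _); apply/rowP => j; rewrite !mxE ltn_ord//.
(* the first k coordinates are enlarged *)
elim: k => [_|k ih kn].
  rewrite mul0r addr0 le_eqVlt; apply/orP; left; apply/eqP.
  by congr V; apply/rowP => j; rewrite !mxE.
pose i := Ordinal kn.
have loS : lo k.+1 = upd (lo k) i (x ord0 i - eta).
  apply/rowP => j; rewrite !mxE; case: eqVneq => [->|]; first by rewrite /= ltnSn.
  by rewrite -val_eqE/= ltnS leq_eqVlt => /negbTE ->.
have hiS : hi k.+1 = upd (hi k) i (y ord0 i + eta).
  apply/rowP => j; rewrite !mxE; case: eqVneq => [->|]; first by rewrite /= ltnSn.
  by rewrite -val_eqE/= ltnS leq_eqVlt => /negbTE ->.
have loi : lo k ord0 i = x ord0 i by rewrite mxE ltnn.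
have hii : hi k ord0 i = y ord0 i by rewrite mxE ltnn.
have xyi := xy i.
rewrite (addV.2 _ _ i (x ord0 i))//; last first.
  by rewrite loS hiS !updE eqxx; apply/andP; split; lra.
rewrite {2}loS upd_upd -loi upd_id loi.
rewrite (addV.2 (lo k) _ i (y ord0 i)); last 2 first.
- by rewrite hiS; apply: vle_updr => //; rewrite loi; lra.
- by rewrite hiS !updE eqxx loi; apply/andP; split; lra.
rewrite {2}hiS upd_upd -hii upd_id hii.
have s1 : V (lo k.+1) (upd (hi k.+1) i (x ord0 i)) <= e / (2 * N).
  apply: (slab _ _ i eta) => //.
  - by rewrite loS hiS upd_upd; apply: vle_upd => //; lra.
  - rewrite hiS upd_upd; apply: vle_updl; first exact: hib.
    by rewrite !mxE; lra.
  - by rewrite loS !updE eqxx; lra.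
have s2 : V (upd (lo k) i (y ord0 i)) (hi k.+1) <= e / (2 * N).
  apply: (slab _ _ i eta) => //.
  - apply: vle_updr; first exact: alo.
    by rewrite !mxE; lra.
  - by rewrite hiS; apply: vle_upd => //; lra.
  - by rewrite hiS !updE eqxx; lra.
have eN : e / N = e / (2 * N) + e / (2 * N).
  by rewrite invfM mulrA -mulrDl; congr (_ / _); lra.
rewrite -natr1 mulrDl mul1r {2}eN.
have := ih (ltnW kn); move: s1 s2; move: (e / (2 * N)) (k%:R * _) => E D; lra.
Qed.

Lemma expand_cover X (r : R) (B : nat -> T * T) : vol_continuous V ->
  box_cover X B -> 0 < r ->
  exists B', [/\ forall k, vle (B' k).1 (B' k).2,
    X `<=` \bigcup_k obox (B' k).1 (B' k).2 &
    (\sum_(k <oo) (V (B' k).1 (B' k).2)%:E <=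
     \sum_(k <oo) (V (B k).1 (B k).2)%:E + r%:E)%E].
Proof.
move=> acV [leB XB] r0.
have [eta eta0 Heta] : exists2 eta : nat -> R, (forall k, 0 < eta k) &
    forall k, V ((B k).1 - const_mx (eta k)) ((B k).2 + const_mx (eta k)) <=
      V (B k).1 (B k).2 + r / (2 ^ k.+1)%:R.
  have /choice[eta H] : forall k, exists eta, 0 < eta /\
     V ((B k).1 - const_mx eta) ((B k).2 + const_mx eta) <=
      V (B k).1 (B k).2 + r / (2 ^ k.+1)%:R.
    move=> k.
    have [eta eta0 le] := @expand_box _ _ (r / (2 ^ k.+1)%:R) acV (leB k)
      ltac:(by rewrite divr_gt0// ltr0n expn_gt0).
    by exists eta.
  by exists eta => k; have [] := H k.
exists (fun k => ((B k).1 - const_mx (eta k), (B k).2 + const_mx (eta k))).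
have le' k : vle ((B k).1 - const_mx (eta k)) ((B k).2 + const_mx (eta k)).
  by move=> j; rewrite !mxE; have := leB k j; have := eta0 k; lra.
split=> [//|x Xx|].
  have [k _ [Bx xB]] := XB x Xx; exists k => //= i; rewrite !mxE.
  by have := Bx i; have := xB i; have := eta0 k => ? ? ?; apply/andP; split; lra.
apply: le_trans (epsilon_trick xpredT _ (ltW r0)).
  apply: lee_nneseries => [k _ _|k _]; first by rewrite lee_fin; apply: addV.1; exact: le'.
  by rewrite -EFinD lee_fin; exact: Heta.
by move=> k; rewrite lee_fin; exact: addV.1.
Qed.

(** The upper bound is a covering by a single rectangle; for the lower bound,
    enlarge the rectangles of a covering to open ones and apply [additive_cover]. *)
Lemma generated_box c d : vol_continuous V -> vle c d ->
  mu (box c d) = (V c d)%:E.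
Proof.
move=> acV cd; apply/eqP; rewrite eq_le muV.1//= leNgt; apply/negP => lt1.
have [B cB lt2] := muV.2 _ _ lt1.
have [B' [leB' cB' le1]] := @expand_cover _ 1 _ acV cB ltr01.
have le2 : (\sum_(k <oo) (V (B k).1 (B k).2)%:E)%E \is a fin_num.
  rewrite ge0_fin_numE; first by apply: lt_trans lt2 _; exact: ltry.
  by apply: nneseries_ge0 => k _ _; rewrite lee_fin; apply: addV.1; have [] := cB.
move: lt2; rewrite ltNge => /negP; apply; apply/lee_addgt0Pr => e e0.
have [B1 [leB1 cB1 le3]] := expand_cover acV cB e0.
exact: le_trans (additive_cover addV cd leB1 cB1) le3.
Qed.

End generated.

End outer_box.

(** * Borel sets and Lebesgue measure *)

Section borel.
Context {R : realType} {n : nat}.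
Notation T := 'rV[R]_n.+1.
Implicit Types (c d x y : T).

(** Both kinds of half-spaces are taken as generators, so that rectangles are
    finite intersections of generators and their complements. *)
Definition halfspaces : set (set T) := [set A : set T | exists (i : 'I_n.+1) (t : R),
  A = [set x : T | x ord0 i <= t] \/ A = [set x : T | x ord0 i < t]].

Definition borel := g_sigma_algebraType halfspaces.

Lemma borel_le i t : measurable ([set x : T | x ord0 i <= t] : set borel).
Proof. by apply: sub_sigma_algebra; exists i, t; left. Qed.

Lemma borel_lt i t : measurable ([set x : T | x ord0 i < t] : set borel).
Proof. by apply: sub_sigma_algebra; exists i, t; right. Qed.

Lemma borel_box c d : measurable (box c d : set borel).
Proof.
have -> : box c d = \bigcap_(i in [set: 'I_n.+1])
    ([set x : T | x ord0 i <= d ord0 i] `\` [set x : T | x ord0 i < c ord0 i]).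
  apply/seteqP; split=> [x [cx xd] i _|x H].
    by split => /=; [exact: xd|apply/negP; rewrite -leNgt].
  by split=> i; have [/= ? /negP] := H i I; rewrite -leNgt.
apply: fin_bigcap_measurable => // i _.
by apply: measurableD; [exact: borel_le|exact: borel_lt].
Qed.

Lemma borel_obox c d : measurable (obox c d : set borel).
Proof.
have -> : obox c d = \bigcap_(i in [set: 'I_n.+1])
    ([set x : T | x ord0 i < d ord0 i] `\` [set x : T | x ord0 i <= c ord0 i]).
  apply/seteqP; split=> [x cxd i _|x H i].
    by have /andP[cx xd] := cxd i; split => //=; apply/negP; rewrite -ltNge.
  by have [/= -> /negP] := H i I; rewrite -ltNge andbT.
apply: fin_bigcap_measurable => // i _.
by apply: measurableD; [exact: borel_lt|exact: borel_le].
Qed.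

Lemma borel_caratheodory (mu : {outer_measure set T -> \bar R})
    (V : T -> T -> R) : box_additive V -> generated mu V ->
  forall A : set borel, measurable A -> mu.-caratheodory A.
Proof.
move=> addV muV; apply: smallest_sub.
  exact: (@sigma_algebra_measurable _ (caratheodory_type mu)).
move=> A [i [t [->|->]]]; apply: (halfspace_caratheodory addV muV (i := i) (t := t)).
- by [].
- by move=> x /= /negP; rewrite -ltNge => /ltW.
- by move=> x /= /ltW.
- by move=> x /= /negP; rewrite -leNgt.
Qed.

Lemma lebesgue_generated : generated (@lebesgue_outer R n) box_volume.
Proof.
split=> [c d cd|X r].
  apply: ereal_inf_lbound.
  exists (fun k => if k is 0%N then (c, d) else (0 : T, 0 : T)).
    split=> [[|k]//|x cxd]; first by exists 0%N.
  rewrite nneseries_recl//=; last first.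
    by move=> k _; case: k => [|k]; rewrite lee_fin; apply: additive_box_volume.1.
  rewrite eseries_cond/= eseries0 ?adde0// => -[//|k] _ _ /=.
  by rewrite /box_volume big_ord_recl subrr mul0r.
by move=> /ereal_inf_lt[_ [B XB <-]] ?; exists B.
Qed.

Lemma vol_continuous_box_volume : vol_continuous (@box_volume R n.+1).
Proof. by move=> a b e e0; exists e => // x y _ _ _ /ltW. Qed.

Let L := lebesgue_rV R n.

Lemma borel_lebesgue (A : set borel) : measurable A ->
  measurable (A : set (caratheodory_type (@lebesgue_outer R n))).
Proof. exact: (borel_caratheodory additive_box_volume lebesgue_generated). Qed.

Lemma lebesgue_null_measurable (Z : set (caratheodory_type (@lebesgue_outer R n))) :
  L Z = 0%E -> measurable Z.
Proof.
move=> Z0; apply: le_caratheodory_measurable => X.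
have XZ0 : lebesgue_outer (X `&` Z) = 0%E.
  apply/eqP; rewrite eq_le lebesgue_outer_ge0 andbT -[leRHS]Z0.
  by apply: le_lebesgue_outer => x [].
rewrite [X in (X + _ <= _)%E]XZ0 add0e.
by apply: le_outer_measure => x [].
Qed.

Lemma lebesgue_box c d : vle c d -> L (box c d) = (box_volume c d)%:E.
Proof.
exact: (generated_box additive_box_volume lebesgue_generated vol_continuous_box_volume).
Qed.

(** The boundary is covered by the faces, which are degenerate rectangles. *)
Lemma lebesgue_boundary c d : vle c d -> L (box c d `\` obox c d) = 0%E.
Proof.
move=> cd; apply/eqP; rewrite eq_le lebesgue_outer_ge0 andbT.
pose F k := let i := inord k : 'I_n.+1 in
  box c (upd d i (c ord0 i)) `|` box (upd c i (d ord0 i)) d.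
have sub : box c d `\` obox c d `<=` \big[setU/set0]_(k < n.+1) F k.
  move=> x [[cx xd]]; rewrite /obox/= => /existsNP[i /negP].
  rewrite negb_and -!leNgt => xi.
  rewrite -bigcup_mkord; exists (val i) => //=; rewrite /F inord_val.
  case/orP: xi => xi; [left|right]; split => //.
    by apply: vle_updr.
  by apply: vle_updl.
apply: le_trans (le_outer_measure (@lebesgue_outer R n) _ _ sub) _.
apply: le_trans (outer_measure_subadditive _ _ _) _.
rewrite big1// => k _; apply/eqP; rewrite eq_le outer_measure_ge0 andbT.
rewrite /F; apply: le_trans (outer_measureU2 _ _ _) _.
have l1 : vle c (upd d (inord k) (c ord0 (inord k))) by exact: vle_updr.
have l2 : vle (upd c (inord k) (d ord0 (inord k))) d by exact: vle_updl.
have e1 : lebesgue_outer (box c (upd d (inord k) (c ord0 (inord k)))) = 0%E.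
  rewrite [LHS](lebesgue_box l1) (additive_degenerate additive_box_volume (i := inord k) l1)//.
  by rewrite updE eqxx.
have e2 : lebesgue_outer (box (upd c (inord k) (d ord0 (inord k))) d) = 0%E.
  rewrite [LHS](lebesgue_box l2) (additive_degenerate additive_box_volume (i := inord k) l2)//.
  by rewrite updE eqxx.
suff : (lebesgue_outer (box c (upd d (inord k) (c ord0 (inord k)))) +
  lebesgue_outer (box (upd c (inord k) (d ord0 (inord k))) d) <= 0)%E by [].
by rewrite e1 e2 adde0.
Qed.

Lemma lebesgue_obox c d : vle c d -> L (obox c d) = (box_volume c d)%:E.
Proof.
move=> cd; rewrite -lebesgue_box//.
have mo := borel_lebesgue (borel_obox c d).
have mb := borel_lebesgue (borel_box c d).
rewrite -[X in _ = L X](setDKU (@obox_box _ _ c d)).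
rewrite [RHS](measureU (lebesgue_rV R n))//; last 2 first.
- exact: measurableD.
- by rewrite setDE -setIA setICl setI0.
transitivity (0 + L (obox c d))%E; first by rewrite add0e.
by congr (_ + _)%E; exact/esym/lebesgue_boundary.
Qed.

End borel.

(** * Upper bound for the integral of a lower derivate *)

Section integral_le.
Context d (T : measurableType d) (R : realType).
Variable mu : {measure set T -> \bar R}.
Implicit Types (D : set T).
Local Open Scope ereal_scope.

(** The functions may fail to be measurable: the integral of a nonnegative
    function is the supremum of the integrals of the simple functions below it. *)
Lemma integral_mono D (f g : T -> \bar R) :
  (forall x, D x -> 0 <= f x) -> (forall x, D x -> f x <= g x) ->
  \int[mu]_(x in D) f x <= \int[mu]_(x in D) g x.
Proof.
move=> f0 fg; rewrite !ge0_integralE//; last first.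
  by move=> x Dx; apply: le_trans (f0 x Dx) (fg x Dx).
apply: le_ereal_sup => _ [h /= hf <-]; exists h => //= x.
by apply: le_trans (hf x) _; rewrite /patch; case: ifPn => //; rewrite inE => /fg.
Qed.

Lemma le_limn_einf (u : (\bar R)^nat) (l : R) :
  (forall e : R, (0 < e)%R -> exists N, forall k, (N <= k)%N -> (l - e)%:E <= u k) ->
  l%:E <= limn_einf u.
Proof.
move=> H; rewrite limn_einf_lim.
have cvgE := ereal_nondecreasing_cvgn (@nondecreasing_einfs _ u).
rewrite (cvg_lim _ cvgE)//; apply/lee_addgt0Pr => e e0.
have [N HN] := H e e0; rewrite -leeBlDr//.
apply: le_ereal_sup_tmp; exists (einfs u N); first by exists N.
by apply: le_ereal_inf_tmp => _ [k /= Nk <-]; rewrite -EFinB; exact: HN.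
Qed.

(** Fatou's lemma for a limit that is not known to be measurable, and that only
    has to be bounded by the lower limit of the sequence. *)
Lemma fatou_le D (u : (T -> \bar R)^nat) (f : T -> R) (M : R) :
  measurable D -> (forall k, measurable_fun D (u k)) ->
  (forall k x, D x -> 0 <= u k x) ->
  (forall k, \int[mu]_(x in D) u k x <= M%:E) ->
  (forall x, D x -> (0 <= f x)%R) ->
  (forall x, D x -> forall e : R, (0 < e)%R ->
     exists N, forall k, (N <= k)%N -> (f x - e)%:E <= u k x) ->
  \int[mu]_(x in D) (f x)%:E <= M%:E.
Proof.
move=> mD mu_ u0 uM f0 fu.
apply: (@le_trans _ _ (\int[mu]_(x in D) limn_einf (u ^~ x))).
  apply: integral_mono => x Dx; first by rewrite lee_fin f0.
  by apply: le_limn_einf => e e0; exact: fu.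
apply: le_trans (fatou mu mD mu_ u0) _.
rewrite limn_einf_lim.
have cvgE := ereal_nondecreasing_cvgn
  (@nondecreasing_einfs _ (fun n => \int[mu]_(x in D) u n x)).
rewrite (cvg_lim _ cvgE)//; apply: ge_ereal_sup => _ [N _ <-].
apply: le_trans (uM N); apply: ereal_inf_lbound; exists N => //=.
Qed.

End integral_le.

Section upper_sum.
Context {R : realType} {n : nat}.
Notation T := 'rV[R]_n.+1.
Notation L := (lebesgue_rV R n).
Variable V : T -> T -> R.
Hypothesis addV : box_additive V.

(** The summands are blocks of [m.+1] cells per side, one block for each cell
    of the lattice. Each block is the sum of its cells, and the cells in a given
    position [q] of their blocks are cells of one translated lattice: their total
    is at most [V c d], and there are [m.+1 ^+ n.+1] positions. *)
Lemma shifted_grid_sum (c d : T) (eta : R) (m K : nat) : vle c d -> 0 <= eta ->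
  (0 < K)%N ->
  \sum_(p : {ffun 'I_n.+1 -> 'I_K}) clamped c d V
     (\row_i (c ord0 i + eta * (p i)%:R))
     (\row_i (c ord0 i + eta * (p i + m.+1)%:R)) <=
  m.+1%:R ^+ n.+1 * V c d.
Proof.
move=> cd eta0 K0.
have addW : box_additive (clamped c d V).
  by apply: additive_clamped => //; exact: additive_additive_on.
have tle (g : 'I_n.+1 -> nat) : forall i,
    {homo (fun k => c ord0 i + eta * (g i + k)%:R) : k l / (k <= l)%N >-> k <= l}.
  by move=> i k l kl; rewrite lerD2l ler_wpM2l// ler_nat leq_add2l.
have split_p (p : {ffun 'I_n.+1 -> 'I_K}) : clamped c d V
     (\row_i (c ord0 i + eta * (p i)%:R))
     (\row_i (c ord0 i + eta * (p i + m.+1)%:R)) =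
   \sum_(q : {ffun 'I_n.+1 -> 'I_m.+1}) clamped c d V
     (\row_i (c ord0 i + eta * (p i + q i)%:R))
     (\row_i (c ord0 i + eta * (p i + (q i).+1)%:R)).
  rewrite (additive_grid addW (t := fun i k => c ord0 i + eta * (p i + k)%:R) _ (tle _))//.
  by congr (clamped c d V _ _); apply/rowP => i; rewrite !mxE ?addn0.
rewrite (eq_bigr _ (fun p _ => split_p p)) exchange_big/=.
apply: (@le_trans _ _ (\sum_(q : {ffun 'I_n.+1 -> 'I_m.+1}) V c d)); last first.
  by rewrite sumr_const card_ffun !card_ord -natrX mulr_natl.
apply: ler_sum => q _.
rewrite (eq_bigr (fun p : {ffun 'I_n.+1 -> 'I_K} => clamped c d V
     (\row_i (c ord0 i + eta * (q i + p i)%:R))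
     (\row_i (c ord0 i + eta * (q i + (p i).+1)%:R)))); last first.
  move=> p _; congr (clamped c d V _ _); apply/rowP => i; rewrite !mxE.
    by rewrite addnC.
  by rewrite addnS -addSn addnC.
rewrite (additive_grid addW (t := fun i k => c ord0 i + eta * (q i + k)%:R) _ (tle _))//.
apply: (additive_mono addV); [exact: clamp_ge| |exact: clamp_le].
by apply: vle_clamp => i; rewrite !mxE; exact: (tle (fun i => q i : nat)).
Qed.

(** The hypothesis says that [g x] is at most the lower derivate of [V] at [x]
    along the cubes [[x, x + h]]. The [k]-th upper function [u k] takes [h = 1 / m]
    and a lattice of mesh [h / m], so that on each cell it is at least
    [V x (x + h) / h ^+ n.+1]; its integral is at most [(1 + 1 / m) ^+ n.+1 * V c d]
    by [shifted_grid_sum]. *)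
Lemma integral_derivate_le (c d : T) (g : T -> R) : vle c d ->
  (forall x, obox c d x -> 0 <= g x) ->
  (forall x, obox c d x -> forall r, r < g x -> exists2 h0 : R, 0 < h0 &
     forall h, 0 < h < h0 -> r * h ^+ n.+1 <= V x (x + const_mx h)) ->
  (\int[L]_(x in obox c d) (g x)%:E <= (V c d)%:E)%E.
Proof.
move=> cd g0 gV; apply/lee_addgt0Pr => eps eps0; rewrite -EFinD.
pose W := clamped c d V.
have addW : box_additive W.
  by apply: additive_clamped => //; exact: additive_additive_on.
have [S S0 HS] : exists2 S : nat, (0 < S)%N & forall i, d ord0 i - c ord0 i <= S%:R.
  pose M := \sum_i (d ord0 i - c ord0 i).
  exists (Num.bound M).+1 => // i; apply: (@le_trans _ _ M).
    rewrite /M (bigD1 i)//= lerDl; apply: sumr_ge0 => j _; rewrite subr_ge0; exact: cd.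
  apply/ltW; apply: lt_trans (archi_boundP _) _; last by rewrite ltr_nat.
  by apply: sumr_ge0 => j _; rewrite subr_ge0; exact: cd.
(* starting the sequence at N0 keeps all integrals below V c d + eps *)
have [N0 HN0] : exists N0, forall m, (N0 <= m)%N ->
    (1 + (m.+1)%:R^-1) ^+ n.+1 * V c d <= V c d + eps.
  have cv : (fun m : nat => (1 + (m.+1)%:R^-1) ^+ n.+1 * V c d) @ \oo --> (1 + 0) ^+ n.+1 * V c d.
    have c1 : (fun m : nat => 1 + (m.+1)%:R^-1) @ \oo --> (1 + 0 : R).
      by apply: cvgD; [exact: cvg_cst|exact: cvg_harmonic].
    apply: cvgM; last exact: cvg_cst.
    exact: (cvg_comp _ _ c1 (@exprn_continuous R n.+1 (1 + 0))).
  rewrite addr0 expr1n mul1r in cv.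
  have lte : V c d < V c d + eps by rewrite ltrDl.
  by have [N0 _ HN] := cvgr_le _ cv _ lte; exists N0 => m Nm; exact: HN.
pose mm k := (k + N0).+1.
pose K k := (mm k * mm k * S)%N.
have mm0 k : 0 < (mm k)%:R :> R by rewrite ltr0n.
pose h k : R := (mm k)%:R^-1.
pose eta k : R := h k / (mm k)%:R.
have h0 k : 0 < h k by rewrite invr_gt0.
have eta0 k : 0 < eta k by rewrite divr_gt0.
have etam k : eta k * (mm k)%:R = h k by rewrite /eta divfK// gt_eqF.
pose lo k (p : {ffun 'I_n.+1 -> 'I_(K k)}) : T :=
  \row_i (c ord0 i + eta k * (p i)%:R).
pose hi k (p : {ffun 'I_n.+1 -> 'I_(K k)}) : T :=
  \row_i (c ord0 i + eta k * (p i).+1%:R).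
pose Hi k (p : {ffun 'I_n.+1 -> 'I_(K k)}) : T :=
  \row_i (c ord0 i + eta k * (p i + (mm k).+1)%:R).
pose w k p := W (lo k p) (Hi k p) / h k ^+ n.+1.
have lohi k p : vle (lo k p) (hi k p).
  by move=> i; rewrite !mxE lerD2l ler_wpM2l ?(ltW (eta0 k))// ler_nat.
have loHi k p : vle (lo k p) (Hi k p).
  by move=> i; rewrite !mxE lerD2l ler_wpM2l ?(ltW (eta0 k))// ler_nat leq_addr.
have w0 k p : 0 <= w k p.
  by rewrite divr_ge0 ?exprn_ge0 ?(ltW (h0 k))// addW.1.
pose u k x : \bar R := (\sum_p (w k p)%:E * (\1_(box (lo k p) (hi k p)) x)%:E)%E.
have mO := borel_lebesgue (borel_obox c d).
have mB k p := borel_lebesgue (borel_box (lo k p) (hi k p)).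
have mterm k p : measurable_fun (obox c d : set (caratheodory_type (@lebesgue_outer R n)))
    (fun x => (w k p)%:E * (\1_(box (lo k p) (hi k p)) x)%:E)%E.
  by apply: measurable_funeM; apply/measurable_EFinP; exact: measurable_indic.
apply: (@fatou_le _ _ _ L (obox c d) u).
- exact: mO.
- by move=> k; apply: emeasurable_sum => p; exact: mterm.
- move=> k x _; apply: sume_ge0 => p _.
  by rewrite mule_ge0 ?lee_fin ?w0.
- move=> k; rewrite ge0_integral_sum//; last first.
    by move=> p x _; rewrite mule_ge0 ?lee_fin ?w0.
  apply: le_trans (_ : (\sum_p (w k p * eta k ^+ n.+1)%:E)%E <= _)%E.
    apply: lee_sum => p _.
    have mI : measurable_fun (obox c d : set (caratheodory_type (@lebesgue_outer R n)))
        (fun x => (\1_(box (lo k p) (hi k p)) x)%:E : \bar R).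
      by apply/measurable_EFinP; exact: measurable_indic.
    have I0 (x : T) : obox c d x -> (0 <= (\1_(box (lo k p) (hi k p)) x : R)%:E)%E.
      by rewrite lee_fin.
    rewrite (ge0_integralZl L mO mI I0) ?lee_fin//.
    rewrite [leRHS]EFinM. apply: lee_wpmul2l; first by rewrite lee_fin.
    rewrite integral_indic//.
    have sub : box (lo k p) (hi k p) `&` obox c d `<=` box (lo k p) (hi k p).
      by move=> z [].
    apply: le_trans (le_outer_measure (@lebesgue_outer R n) _ _ sub) _.
    rewrite [X in (X <= _)%E](lebesgue_box (lohi k p)) lee_fin /box_volume.
    rewrite (eq_bigr (fun=> eta k)) ?prodr_const ?card_ord// => i _.
    by rewrite !mxE -natr1; lra.
  rewrite sumEFin lee_fin.
  have -> : \sum_p w k p * eta k ^+ n.+1 =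
      (\sum_p W (lo k p) (Hi k p)) / (mm k)%:R ^+ n.+1.
    rewrite mulr_suml; apply: eq_bigr => p _; rewrite /w /eta.
    by rewrite expr_div_n mulrA divfK// expf_neq0// gt_eqF.
  apply: le_trans (HN0 (k + N0)%N (leq_addl _ _)).
  rewrite ler_pdivrMr ?exprn_gt0//.
  apply: le_trans (shifted_grid_sum (mm k) cd (ltW (eta0 k)) _) _.
    by rewrite !muln_gt0.
  rewrite mulrAC -exprMn_comm; last exact: mulrC.
  by rewrite mulrDl mul1r mulVf ?gt_eqF// -/(mm k) natr1.
- by move=> x Ox; exact: g0.
move=> x Ox e e0.
have [hx hx0 Hx] := gV x Ox (g x - e) ltac:(by rewrite ltrBlDr ltrDl).
have [e1 e10 He1] := @fin_lower R 'I_n.+1 (fun i => d ord0 i - x ord0 i)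
  ltac:(by move=> i; rewrite subr_gt0; have /andP[] := Ox i).
have [N _ HN] : \forall k \near \oo, (k.+1)%:R^-1 < Num.min hx e1.
  by apply: (cvgr_lt _ (@cvg_harmonic R)); rewrite lt_min hx0.
exists N => k Nk.
have : h k < Num.min hx e1.
  by apply: (HN (k + N0)%N); rewrite /= (leq_trans Nk)// leq_addr.
rewrite lt_min => /andP[hkx hke1].
have cell i : exists p : 'I_(K k),
    c ord0 i + eta k * p%:R <= x ord0 i <= c ord0 i + eta k * p.+1%:R.
  have /andP[cx xd] := Ox i.
  apply: lattice_cell => //; first exact: ltW.
  apply: lt_le_trans xd _; rewrite -lerBlDl; apply: le_trans (HS i) _.
  rewrite /K /eta /h !natrM.
  have := mm0 k; move: (_%:R) (S%:R) => M s M0.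
  by rewrite le_eqVlt; apply/orP; left; apply/eqP; field; rewrite gt_eqF.
have [p Hp] := choice cell.
pose pf : {ffun 'I_n.+1 -> 'I_(K k)} := [ffun i => p i].
apply: (@le_trans _ _ (w k pf)%:E); last first.
  rewrite /u (bigD1 pf)//= indicE mem_set ?mule1; last first.
    by split=> i; rewrite mxE ffunE; have /andP[] := Hp i.
  rewrite leeDl//; apply: sume_ge0 => q _.
  by rewrite mule_ge0 ?lee_fin ?w0.
rewrite lee_fin /w ler_pdivlMr ?exprn_gt0//.
apply: le_trans (Hx (h k) _) _; first by rewrite h0.
have xh : vle x (x + const_mx (h k)).
  by move=> i; rewrite !mxE lerDl ltW.
have -> : V x (x + const_mx (h k)) = W x (x + const_mx (h k)).
  rewrite /W /clamped; congr V; rewrite clamp_id// => i; rewrite ?mxE;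
  have /andP[cx xd] := Ox i; have := He1 i; have := h0 k; lra.
apply: (additive_mono addW) => // i; rewrite !mxE ffunE; have /andP[p1 p2] := Hp i.
  by [].
rewrite addnS -addSn natrD mulrDr etam addrA lerD2r//.
Qed.

End upper_sum.

(** * The joint derivative *)

Section integral_tools.
Context d (T : measurableType d) (R : realType).
Variable mu : {measure set T -> \bar R}.
Local Open Scope ereal_scope.
Import HBNNSimple.

(** The supremum of a maximizing sequence of simple functions. It replaces a
    function whose measurability is unknown by a measurable one with the same
    integral. *)
Lemma integral_measurable_minorant (f : T -> R) : (forall x, (0 <= f x)%R) ->
  exists g : T -> R, [/\ measurable_fun setT g,
    forall x, (0 <= g x <= f x)%R &
    \int[mu]_x (g x)%:E = \int[mu]_x (f x)%:E].
Proof.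
move=> f0; pose S := [set sintegral mu h |
  h in [set h : {nnsfun T >-> R} | forall x, (h x)%:E <= (f x)%:E]].
have intE : \int[mu]_x (f x)%:E = ereal_sup S.
  by rewrite ge0_integralTE// => x; rewrite lee_fin.
have S0 : S !=set0.
  by exists (sintegral mu (@nnsfun0 _ T R)), nnsfun0 => //= x; rewrite lee_fin f0.
have [u uS ucvg] := ereal_sup_seq ((set0P S).2 S0).
have [h hP] : exists h : nat -> {nnsfun T >-> R}, forall k,
    (forall x, (h k x)%:E <= (f x)%:E) /\ sintegral mu (h k) = u k.
  suff /choice[h H] : forall k, exists h : {nnsfun T >-> R},
      (forall x, (h x)%:E <= (f x)%:E) /\ sintegral mu h = u k by exists h.
  by move=> k; have [h hf <-] := uS k; exists h.
pose G x := ereal_sup (range (fun k => (h k x)%:E)).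
have hG k x : (h k x)%:E <= G x by apply: ereal_sup_ubound; exists k.
have Gf x : G x <= (f x)%:E by apply: ge_ereal_sup => _ [k _ <-]; have [] := hP k.
have G0 x : 0 <= G x by apply: le_trans (hG 0%N x); rewrite lee_fin.
have Gfin x : G x \is a fin_num by rewrite ge0_fin_numE// (le_lt_trans (Gf x))// ltry.
have mG : measurable_fun setT G.
  rewrite (_ : G = fun x => esups (fun k => (h k x)%:E) 0%N).
    apply: measurable_fun_esups => k; apply/measurable_EFinP.
    exact: measurable_funP.
  apply/funext => x; congr ereal_sup; apply/seteqP; split => _ [k _ <-];
    by exists k.
exists (fine \o G); split.
- exact: measurableT_comp.
- by move=> x /=; rewrite fine_ge0//= -lee_fin fineK.
apply/eqP; rewrite eq_le; apply/andP; split.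
  by apply: integral_mono => x _; rewrite lee_fin ?fine_ge0//= -lee_fin fineK.
rewrite intE -(cvg_lim _ ucvg)//; apply: lime_le; first by apply/cvg_ex; exists (ereal_sup S).
apply: nearW => k; have [_ <-] := hP k.
rewrite -[leLHS](_ : \int[mu]_x (h k x)%:E = _); last first.
  by rewrite integral_nnsfun// patch_setT.
apply: integral_mono => x _; first by rewrite lee_fin.
by rewrite fineK.
Qed.

Lemma integral_small (f : T -> R) (e : R) : (forall x, (0 <= f x)%R) ->
  mu.-integrable setT (EFin \o f) -> (0 < e)%R ->
  exists2 del : R, (0 < del)%R & forall A, measurable A -> mu A < del%:E ->
    \int[mu]_(x in A) (f x)%:E < e%:E.
Proof.
move=> f0 intf e0; have [del [del0 H]] := integral_normr_continuous intf e0.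
exists del => // A mA Adel; have := H A mA Adel.
have -> : \int[mu]_(x in A) (f x)%:E = \int[mu]_(x in A) `|(f x)%:E|.
  by apply: eq_integral => x _; rewrite gee0_abs// lee_fin.
rewrite /Rintegral -lte_fin fineK//.
have /integrableP[_] : mu.-integrable A (EFin \o f) by exact: integrableS intf.
by move=> H1; rewrite ge0_fin_numE// integral_ge0.
Qed.

End integral_tools.

Section interior.
Context {R : realType} {n : nat}.
Notation T := 'rV[R]_n.+1.
Implicit Types (c d x y : T).

Lemma obox_interior c d : obox c d `<=` (box c d)°.
Proof.
move=> x Ox.
have [e e0 He] := @fin_lower R 'I_n.+1
  (fun i => Num.min (x ord0 i - c ord0 i) (d ord0 i - x ord0 i)) ltac:(
    by move=> i; have /andP[? ?] := Ox i; rewrite lt_min !subr_gt0; apply/andP).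
apply/nbhs_ballP; exists e => // y xy; split=> i; have := He i; rewrite le_min;
  have := xy.2 ord0 i; rewrite /ball/= ltr_norml => /andP[? ?] /andP[? ?]; lra.
Qed.

Lemma interior_obox c d : (box c d)° `<=` obox c d.
Proof.
move=> x /nbhs_ballP[e /= e0 He] i.
have Hs (s : R) : `|s| < e -> box c d (x + const_mx s).
  by move=> se; apply: He; split=> // k j; rewrite !mxE/= /ball/= opprD addNKr normrN.
have [|cx _] := Hs (- (e / 2)); first by rewrite normrN gtr0_norm; lra.
have [|_ xd] := Hs (e / 2); first by rewrite gtr0_norm; lra.
by have := cx i; have := xd i; rewrite !mxE => ? ?; apply/andP; split; lra.
Qed.

Lemma near_rightP (P : R -> Prop) : (\forall h \near 0^'+, P h) ->
  exists2 h0 : R, 0 < h0 & forall h, 0 < h < h0 -> P h.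
Proof.
move=> /nbhs_ballP[e /= e0 He]; exists e => // h /andP[h0 he]; apply: He => //=.
by rewrite /ball/= sub0r normrN gtr0_norm.
Qed.

End interior.

Section joint_derivative.
Context {R : realType} {n : nat}.
Notation T := 'rV[R]_n.+1.
Notation L := (lebesgue_rV R n).
Variables (a b : T) (f : T -> R).
Hypotheses (ab : vle a b) (incf : jointly_increasing f a b).
Notation F := (joint_increment f).
Notation V := (clamped a b (joint_increment f)).
Notation g := (joint_derivative f (box a b)).

Lemma additive_clamped_increment : box_additive V.
Proof. by apply: additive_clamped => //; exact: additive_joint_increment. Qed.

Lemma clampedE c d : vle a c -> vle c d -> vle d b -> V c d = F c d.
Proof.
move=> ac cd db; have cb := vle_trans cd db; have ad := vle_trans ac cd.
by rewrite /clamped !clamp_id.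
Qed.

Lemma small_cube_sub x : obox a b x -> exists2 h0 : R, 0 < h0 &
  forall h, 0 < h < h0 -> vle (x + const_mx h) b.
Proof.
move=> Ox.
have [e e0 He] := @fin_lower R 'I_n.+1 (fun i => b ord0 i - x ord0 i)
  ltac:(by move=> i; rewrite subr_gt0; have /andP[] := Ox i).
by exists e => // h /andP[h0 he] i; rewrite !mxE; have := He i; lra.
Qed.

Lemma joint_quotientE x : obox a b x -> exists2 h0 : R, 0 < h0 &
  forall h, 0 < h < h0 -> joint_quotient f x h = V x (x + const_mx h) / h ^+ n.+1.
Proof.
move=> Ox; have [h0 h00 H] := small_cube_sub Ox; exists h0 => // h hh.
rewrite /joint_quotient clampedE//; last exact: H.
  by have [] := obox_box Ox.
by move=> i; rewrite !mxE lerDl; case/andP: hh => /ltW.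
Qed.

(** A point of the boundary has no neighbourhood in the domain, hence no joint
    derivative, and the conventional value applies. *)
Lemma joint_derivative_out x : ~ obox a b x -> g x = 0.
Proof.
move=> nO; rewrite /joint_derivative asboolF// => -[/interior_obox Ox _]; exact: nO.
Qed.

Lemma joint_derivative_lower x r : obox a b x -> r < g x ->
  exists2 h0 : R, 0 < h0 &
    forall h, 0 < h < h0 -> r * h ^+ n.+1 <= V x (x + const_mx h).
Proof.
move=> Ox; rewrite /joint_derivative; case: asboolP => [[_ cv] rg|_ r0].
  have [h1 h10 H1] := joint_quotientE Ox.
  have [h2 h20 H2] := near_rightP (cvgr_gt _ cv _ rg).
  exists (Num.min h1 h2); first by rewrite lt_min h10.
  move=> h /andP[h0]; rewrite lt_min => /andP[hh1 hh2].
  have := H2 h; rewrite h0 => /(_ hh2); rewrite H1 ?h0// => /ltW.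
  by rewrite ler_pdivlMr// exprn_gt0.
exists 1 => // h /andP[h0 _]; apply: (@le_trans _ _ 0).
  by rewrite mulr_le0_ge0 ?ltW// exprn_gt0.
by apply: additive_clamped_increment.1 => i; rewrite !mxE lerDl ltW.
Qed.

Lemma joint_derivative_ge0 x : 0 <= g x.
Proof.
have [Ox|nO] := pselect (obox a b x); last by rewrite joint_derivative_out.
rewrite /joint_derivative; case: asboolP => // -[_ cv].
apply: limr_ge => //.
have [h1 h10 H1] := joint_quotientE Ox.
apply/nbhs_ballP; exists h1 => //= h; rewrite /ball/= sub0r normrN => hh h0.
have h0' : 0 < h by [].
rewrite H1; last by rewrite h0'/= -[h]gtr0_norm.
apply: divr_ge0; last by rewrite exprn_ge0// ltW.
by apply: additive_clamped_increment.1 => i; rewrite !mxE lerDl ltW.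
Qed.

Lemma integral_joint_derivative_le c d : vle a c -> vle c d -> vle d b ->
  (\int[L]_(x in obox c d) (g x)%:E <= (F c d)%:E)%E.
Proof.
move=> ac cd db; rewrite -(clampedE ac cd db).
apply: integral_derivate_le => //; first exact: additive_clamped_increment.
  by move=> x _; exact: joint_derivative_ge0.
move=> x Ox r rg; apply: joint_derivative_lower => // i.
have /andP[cx xd] := Ox i.
by rewrite (le_lt_trans (ac i) cx) (lt_le_trans xd (db i)).
Qed.

End joint_derivative.

(** * Sufficiency: indefinite integrals are absolutely continuous *)

Section density.
Context {R : realType} {n : nat}.
Notation T := 'rV[R]_n.+1.
Notation TL := (caratheodory_type (@lebesgue_outer R n)).
Notation L := (lebesgue_rV R n).
Variable h : T -> R.
Hypotheses (mh : measurable_fun (setT : set TL) h) (h0 : forall x, 0 <= h x).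

Let mhE (D : set TL) : measurable_fun D (fun x => (h x)%:E).
Proof. by apply/measurable_EFinP; exact: measurable_funS mh. Qed.

Let hE0 (D : set T) (x : T) : D x -> (0 <= (h x)%:E)%E.
Proof. by rewrite lee_fin. Qed.

Lemma integral_null (N : set TL) : measurable N -> L N = 0%E ->
  (\int[L]_(x in N) (h x)%:E = 0)%E.
Proof. by move=> mN N0; apply: null_set_integral. Qed.

Lemma integral_setD (A B : set TL) : measurable A -> measurable B ->
  L (A `&` B) = 0%E ->
  (\int[L]_(x in A) (h x)%:E = \int[L]_(x in A `\` B) (h x)%:E)%E.
Proof.
move=> mA mB AB0; rewrite -{1}(setUIDK A B) ge0_integral_setU//.
- by rewrite (integral_null (N := A `&` B)) ?add0e//; exact: measurableI.
- exact: measurableI.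
- exact: measurableD.
- by move=> x _; rewrite lee_fin.
- by apply/eqP; rewrite -subset0 => x [[_ Bx] [_]].
Qed.

Lemma integral_box c d : vle c d ->
  (\int[L]_(x in box c d) (h x)%:E = \int[L]_(x in obox c d) (h x)%:E)%E.
Proof.
move=> cd.
have mb := borel_lebesgue (borel_box c d).
have mo := borel_lebesgue (borel_obox c d).
have md : measurable (box c d `\` obox c d : set TL) by exact: measurableD.
rewrite (integral_setD mb md); last first.
  by rewrite setIDA setIid; exact: lebesgue_boundary.
by rewrite setDD setIC (setIidl (@obox_box _ _ c d)).
Qed.

(** The two pieces overlap in a degenerate rectangle, which is null. *)
Lemma integral_box_cut c d i t : vle c d -> c ord0 i <= t <= d ord0 i ->
  (\int[L]_(x in box c d) (h x)%:E = \int[L]_(x in box c (upd d i t)) (h x)%:E +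
   \int[L]_(x in box (upd c i t) d) (h x)%:E)%E.
Proof.
move=> cd /andP[ct td].
set A := box c (upd d i t); set B := box (upd c i t) d.
have mA : measurable (A : set TL) := borel_lebesgue (borel_box _ _).
have mB : measurable (B : set TL) := borel_lebesgue (borel_box _ _).
have cdt : vle c (upd d i t) by exact: vle_updr.
have ctd : vle (upd c i t) d by exact: vle_updl.
have -> : box c d = A `|` (B `\` A).
  apply/seteqP; split=> [x [cx xd]|x [[cx xd]|[[cx xd] _]]].
  - have [xt|tx] := leP (x ord0 i) t.
      left; split => // j; rewrite updE; case: eqVneq => // ->.
      by [].
    right; split.
      by split => // j; rewrite updE; case: eqVneq => // ->; exact: ltW.
    by move=> [_ /(_ i)]; rewrite updE eqxx leNgt tx.
  - split => // j; have := xd j; rewrite updE; case: eqVneq => // -> /le_trans; exact.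
  - split => // j; have := cx j; rewrite updE; case: eqVneq => // ->; exact: le_trans.
rewrite ge0_integral_setU//.
- congr (_ + _)%E; rewrite -integral_setD//.
  apply/eqP; rewrite eq_le lebesgue_outer_ge0 andbT.
  have ctdt : vle (upd c i t) (upd d i t) by exact: vle_upd.
  have sub : B `&` A `<=` box (upd c i t) (upd d i t).
    by move=> x [[? ?] [? ?]].
  apply: le_trans (le_outer_measure (@lebesgue_outer R n) _ _ sub) _.
  rewrite [X in (X <= _)%E](lebesgue_box ctdt).
  rewrite (additive_degenerate additive_box_volume (i := i))//.
  by rewrite !updE eqxx.
- exact: measurableD.
- by move=> x _; rewrite lee_fin.
- by apply/eqP; rewrite -subset0 => x [Ax [_]].
Qed.

End density.

Section sufficiency.
Context {R : realType} {n : nat}.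
Notation T := 'rV[R]_n.+1.
Notation TL := (caratheodory_type (@lebesgue_outer R n)).
Notation L := (lebesgue_rV R n).
Variables (a b : T) (f : T -> R).
Hypotheses (ab : vle a b) (incf : jointly_increasing f a b).
Notation F := (joint_increment f).
Notation g := (joint_derivative f (box a b)).

Lemma joint_derivative_minorant : exists h : T -> R,
  [/\ measurable_fun (setT : set TL) h, forall x, 0 <= h x <= g x &
   (\int[L]_x (h x)%:E = \int[L]_(x in box a b) (g x)%:E)%E].
Proof.
have [h [mh hg hI]] := integral_measurable_minorant L (joint_derivative_ge0 ab incf).
exists h; split => //; rewrite [LHS]hI [RHS]integral_mkcond; apply: eq_integral => x _.
rewrite patchE; case: ifPn => //; rewrite notin_setE => nx.
by rewrite joint_derivative_out// => /obox_box.
Qed.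

(** The difference [G] of the two sides is nonnegative, additive, and zero on
    [[a, b]]; by monotonicity it is zero everywhere. *)
Lemma increment_eq_integral (h : T -> R) :
  measurable_fun (setT : set TL) h -> (forall x, 0 <= h x <= g x) ->
  (\int[L]_x (h x)%:E = (F a b)%:E)%E ->
  forall c d, vle a c -> vle c d -> vle d b ->
  (\int[L]_(x in box c d) (h x)%:E = (F c d)%:E)%E.
Proof.
move=> mh hg hab.
have h0 x : 0 <= h x by have /andP[] := hg x.
have leF c d : vle a c -> vle c d -> vle d b ->
    (\int[L]_(x in box c d) (h x)%:E <= (F c d)%:E)%E.
  move=> ac cd db; rewrite integral_box//.
  apply: le_trans (integral_joint_derivative_le ab incf ac cd db).
  by apply: integral_mono => x _; rewrite lee_fin//; have /andP[] := hg x.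
have ge0 c d : (0 <= \int[L]_(x in box c d) (h x)%:E)%E.
  by apply: integral_ge0 => x _; rewrite lee_fin.
have fin c d : vle a c -> vle c d -> vle d b ->
    (\int[L]_(x in box c d) (h x)%:E)%E \is a fin_num.
  by move=> ac cd db; rewrite ge0_fin_numE// (le_lt_trans (leF _ _ ac cd db))// ltry.
pose G c d := F c d - fine (\int[L]_(x in box c d) (h x)%:E)%E.
have addG : box_additive_on a b G.
  split=> [x y ax xy yb|x y i t ax xy yb xty].
    by rewrite subr_ge0 -lee_fin fineK ?leF// fin.
  have /andP[xt ty] := xty.
  have xyt : vle x (upd y i t) by exact: vle_updr.
  have xty' : vle (upd x i t) y by exact: vle_updl.
  have ytb : vle (upd y i t) b by apply: vle_updl => //; exact: le_trans (yb i).
  have axt : vle a (upd x i t) by apply: vle_updr => //; exact: le_trans xt.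
  rewrite /G (joint_increment_cut f x y i t) (integral_box_cut mh h0 xy xty).
  by rewrite fineD ?fin//; lra.
have Gab : G a b = 0.
  rewrite /G; suff -> : (\int[L]_(x in box a b) (h x)%:E = (F a b)%:E)%E.
    by rewrite subrr.
  rewrite -hab [LHS]integral_mkcond; apply: eq_integral => x _.
  rewrite patchE; case: ifPn => //; rewrite notin_setE => nx.
  have := hg x; rewrite joint_derivative_out; last by move=> /obox_box.
  by move=> ?; congr EFin; lra.
move=> c d ac cd db; apply/eqP; rewrite -(fineK (fin _ _ ac cd db)) eqe.
rewrite eq_sym -subr_eq0 -/(G c d).
have := additive_mono (additive_clamped ab addG) ac cd db.
have [cb ad] := (vle_trans cd db, vle_trans ac cd).
rewrite /clamped !clamp_id// Gab => G0.
by rewrite eq_le G0 addG.1.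
Qed.

(** Rectangles with disjoint interiors have disjoint open versions, over the
    union of which [h] is integrated; the faces are null. *)
Lemma absolutely_continuous_of_integral :
  (\int[L]_(x in box a b) (g x)%:E = (F a b)%:E)%E ->
  jointly_absolutely_continuous f a b.
Proof.
move=> intg eps eps0.
have [h [mh hg hI]] := joint_derivative_minorant.
rewrite intg in hI.
have h0 x : 0 <= h x by have /andP[] := hg x.
have Fh := increment_eq_integral mh hg hI.
have inth : L.-integrable (setT : set TL) (EFin \o h).
  apply/integrableP; split; first exact/measurable_EFinP.
  rewrite (eq_integral (fun x : TL => (h x)%:E)); last first.
    by move=> x _ /=; rewrite ger0_norm.
  by rewrite [X in (X < _)%E]hI ltry.
have [del del0 Hdel] := @integral_small _ TL R L h eps h0 inth eps0.
exists del => // N c d cdab dis small.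
have cd i : vle (c i) (d i) by have [] := cdab i.
have mO i : measurable (obox (c i) (d i) : set TL) := borel_lebesgue (borel_obox _ _).
have tO : trivIset [set: 'I_N] (fun i => obox (c i) (d i) : set TL).
  apply/trivIsetP => i j _ _ ij; rewrite -subset0.
  by rewrite -(dis i j ij); apply: setISS; exact: obox_interior.
rewrite -lte_fin -sumEFin.
rewrite (eq_bigr (fun i => \int[L]_(x in obox (c i) (d i)) (h x)%:E)%E); last first.
  move=> i _; have [ac cd' db] := cdab i.
  rewrite -integral_box// Fh// ger0_norm//; exact: incf.
rewrite -(@ge0_integral_bigsetU _ TL R L 'I_N (fun i => obox (c i) (d i))
  (fun x => (h x)%:E) (index_enum 'I_N) mO (index_enum_uniq _))//=; last 3 first.
- exact: sub_trivIset tO.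
- by apply/measurable_EFinP; exact: measurable_funS mh.
- by move=> x _; rewrite lee_fin.
apply: Hdel; first exact: bigsetU_measurable.
apply: le_lt_trans small; rewrite measure_bigsetU_ord//.
apply: lee_sum => i _; apply: (le_outer_measure (@lebesgue_outer R n)); exact: obox_box.
Qed.

End sufficiency.

(** * Absolute continuity and finite unions of rectangles *)

Lemma outer_measure_big_le (R : realType) (T : Type) (I : finType)
    (mu : {outer_measure set T -> \bar R}) (P : pred I) (A : I -> set T) :
  (mu (\big[setU/set0]_(i | P i) A i) <= \sum_(i | P i) mu (A i))%E.
Proof.
elim/big_ind2 : _ => [|X x Y y Xx Yy|i _]; first by rewrite outer_measure0.
  by apply: le_trans (outer_measureU2 mu x y) _; exact: leeD.
exact: lexx.
Qed.

Section necessity_null.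
Context {R : realType} {n : nat}.
Notation T := 'rV[R]_n.+1.
Notation L := (lebesgue_rV R n).
Variables (a b : T) (f : T -> R).
Hypotheses (ab : vle a b) (incf : jointly_increasing f a b)
  (acf : jointly_absolutely_continuous f a b).
Notation F := (joint_increment f).
Notation V := (clamped a b (joint_increment f)).

Lemma vol_continuous_clamped_increment : vol_continuous V.
Proof.
move=> a' b' e e0; have [del del0 Hdel] := acf e0; exists del => // x y _ xy _ vxy.
have cxy : vle (clamp a b x) (clamp a b y) by exact: vle_clamp.
have := Hdel 1%N (fun=> clamp a b x) (fun=> clamp a b y).
rewrite !big_ord1 => H; apply: le_trans (ler_norm _) _; apply/ltW; apply: H.
- by move=> _; split => //; [exact: clamp_ge|exact: clamp_le].
- by move=> i j; rewrite !ord1 eqxx.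
- rewrite lebesgue_box// lte_fin; apply: le_lt_trans vxy.
  exact: (clamped_le additive_box_volume ab xy).
Qed.

Variable mu : {outer_measure set T -> \bar R}.
Hypothesis muV : generated mu V.

(** Absolute continuity speaks of rectangles that do not overlap, and the
    rectangles [B k] may overlap. Replace them by the cells of a fine lattice which
    meet one of them: these do not overlap, they cover the union, and each lies in
    some [B k] enlarged by the mesh, so that their total volume is still less than
    [del]. *)
Lemma finite_union_small (e del : R) (B : nat -> T * T) (K : nat) :
  (forall (N : nat) (c d : 'I_N -> T),
      (forall i, [/\ vle a (c i), vle (c i) (d i) & vle (d i) b]) ->
      (forall i j, i != j ->
        (box (c i) (d i))° `&` (box (c j) (d j))° = set0) ->
      (\sum_(i < N) L (box (c i) (d i)) < del%:E)%E ->
      \sum_(i < N) `|joint_increment f (c i) (d i)| < e) ->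
  (forall k, vle (B k).1 (B k).2) ->
  \sum_(k < K) box_volume (B k).1 (B k).2 < del ->
  (mu (box a b `&` \bigcup_(k in `I_K) box (B k).1 (B k).2) <= e%:E)%E.
Proof.
move=> acd leB Bdel.
(* enlarging the boxes by eta keeps the total volume below del *)
have [eta eta0 etaB] : exists2 eta : R, 0 < eta &
    \sum_(k < K) box_volume ((B k).1 - const_mx eta) ((B k).2 + const_mx eta) < del.
  pose s := \sum_(k < K) box_volume (B k).1 (B k).2.
  pose r := (del - s) / (K.+1)%:R.
  have r0 : 0 < r by rewrite divr_gt0// subr_gt0.
  have /choice[et Het] : forall k : 'I_K, exists et, 0 < et /\
      box_volume ((B k).1 - const_mx et) ((B k).2 + const_mx et) <=
      box_volume (B k).1 (B k).2 + r.
    move=> k; have [et et0 H] := expand_box additive_box_volume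
      (@vol_continuous_box_volume R n) (leB k) r0.
    by exists et.
  have [eta eta0 He] := fin_lower (fun k => (Het k).1).
  exists eta => //.
  apply: (@le_lt_trans _ _ (\sum_(k < K) (box_volume (B k).1 (B k).2 + r))).
    apply: ler_sum => k _; apply: le_trans (Het k).2.
    have := He k; move=> ek; apply: (additive_mono additive_box_volume);
      move=> i; rewrite !mxE; have := leB k i; lra.
  rewrite big_split/= -/s sumr_const card_ord -mulr_natl.
  suff : K%:R * r < del - s by lra.
  rewrite /r mulrA ltr_pdivrMr// mulrC ltr_pM2l ?subr_gt0//.
  by rewrite ltr_nat.
(* a lattice of mesh eta covering the rectangle *)
pose M := (\sum_i Num.bound ((b ord0 i - a ord0 i) / eta)).+1.
have bM i : b ord0 i < a ord0 i + eta * M%:R.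
  have q0 : 0 <= (b ord0 i - a ord0 i) / eta.
    by rewrite divr_ge0 ?(ltW eta0)// subr_ge0.
  have := archi_boundP q0; rewrite ltr_pdivrMr// => H.
  suff : (Num.bound ((b ord0 i - a ord0 i) / eta))%:R * eta <= eta * M%:R by lra.
  rewrite mulrC ler_pM2l// ler_nat /M (bigD1 i)//=.
  by rewrite ltnW// ltnS leq_addr.
pose lo (p : {ffun 'I_n.+1 -> 'I_M}) : T := \row_i (a ord0 i + eta * (p i)%:R).
pose hi (p : {ffun 'I_n.+1 -> 'I_M}) : T := \row_i (a ord0 i + eta * (p i).+1%:R).
have lohi p : vle (lo p) (hi p).
  by move=> i; rewrite !mxE lerD2l ler_wpM2l ?(ltW eta0)// ler_nat.
pose lo' p := clamp a b (lo p); pose hi' p := clamp a b (hi p).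
have lohi' p : vle (lo' p) (hi' p) by exact: vle_clamp.
pose S : {set {ffun 'I_n.+1 -> 'I_M}} := [set p | `[< exists k : 'I_K,
  (box (lo' p) (hi' p) `&` box (B k).1 (B k).2) !=set0 >]]%SET.
have volS : \sum_(p in S) box_volume (lo' p) (hi' p) < del.
  apply: le_lt_trans etaB.
  pose U k := clamped ((B k).1 - const_mx eta) ((B k).2 + const_mx eta)
    (@box_volume R n.+1).
  have leBe k : vle ((B k).1 - const_mx eta) ((B k).2 + const_mx eta).
    by move=> i; rewrite !mxE; have := leB k i; lra.
  have addU k : box_additive (U k).
    by apply: additive_clamped => //; exact: additive_additive_on additive_box_volume.
  apply: (@le_trans _ _ (\sum_p \sum_(k < K) U k (lo' p) (hi' p))).
    rewrite big_mkcond/=; apply: ler_sum => p _.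
    have U0 (k : 'I_K) : 0 <= U k (lo' p) (hi' p) by exact: (addU k).1.
    case: ifPn => [|_]; last exact: sumr_ge0.
    rewrite inE => /asboolP[k [z [[lz zh] [Bz zB]]]].
    rewrite (bigD1 k)//=; apply: (@le_trans _ _ (U k (lo' p) (hi' p))); last first.
      by rewrite lerDl sumr_ge0.
    have side i : hi' p ord0 i - lo' p ord0 i <= eta.
      apply: le_trans (clamp_width a b i (lohi p)) _.
      by rewrite !mxE -natr1; lra.
    have E1 i : ((B k).1 - const_mx eta) ord0 i = (B k).1 ord0 i - eta by rewrite !mxE.
    have E2 i : ((B k).2 + const_mx eta) ord0 i = (B k).2 ord0 i + eta by rewrite !mxE.
    rewrite /U /clamped !clamp_id// => i; rewrite ?E1 ?E2; have := side i;
      have := lz i; have := zh i; have := Bz i; have := zB i; have := lohi' p i; lra.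
  (* for a fixed k, the intersections of the cells with the enlarged B k add up
     to at most its volume *)
  rewrite exchange_big/=; apply: ler_sum => k _.
  pose W := clamped a b (U k).
  have addW : box_additive W.
    by apply: additive_clamped => //; exact: additive_additive_on.
  have tle i : {homo (fun k => a ord0 i + eta * k%:R) : k l / (k <= l)%N >-> k <= l}.
    by move=> j l jl; rewrite lerD2l ler_wpM2l ?(ltW eta0)// ler_nat.
  rewrite [leLHS](_ : _ = \sum_(p : {ffun 'I_n.+1 -> 'I_M}) W (lo p) (hi p))//.
  rewrite (additive_grid addW (t := fun i k => a ord0 i + eta * k%:R) _ tle)//.
  apply: (additive_mono additive_box_volume); [exact: clamp_ge| |exact: clamp_le].
  by apply: vle_clamp; apply: vle_clamp => i; rewrite !mxE; exact: tle.
(* distinct cells differ in some coordinate, where one ends before the other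
   begins *)
have SF : \sum_(p in S) F (lo' p) (hi' p) < e.
  have := acd #|S| (fun i => lo' (enum_val i)) (fun i => hi' (enum_val i)).
  rewrite -(big_enum_val (A := mem S) (fun p => L (box (lo' p) (hi' p)))).
  rewrite -(big_enum_val (A := mem S) (fun p => `|F (lo' p) (hi' p)|)) => H.
  apply: le_lt_trans (H _ _ _).
  - by apply: ler_sum => p _; exact: ler_norm.
  - by move=> i; split => //; [exact: clamp_ge|exact: clamp_le].
  - move=> i j ij; rewrite -subset0 => x [/interior_obox xi /interior_obox xj].
    have /eqP/ffunP : enum_val i != enum_val j by rewrite (inj_eq enum_val_inj).
    move: (enum_val i) (enum_val j) xi xj => p q xp xq; apply => l.
    apply/val_inj/eqP; rewrite eqn_leq.
    have /andP[p1 p2] := xp l; have /andP[q1 q2] := xq l.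
    have key (u v : {ffun 'I_n.+1 -> 'I_M}) : lo' u ord0 l < hi' v ord0 l -> (u l <= v l)%N.
      rewrite leqNgt => uv; apply/negP => vu; move: uv; rewrite ltNge => /negP; apply.
      have : hi v ord0 l <= lo u ord0 l.
        by rewrite !mxE lerD2l ler_wpM2l ?(ltW eta0)// ler_nat.
      exact: le_clamp.
    by rewrite (key _ _ (lt_trans p1 q2)) (key _ _ (lt_trans q1 p2)).
  - rewrite (eq_bigr (fun p => (box_volume (lo' p) (hi' p))%:E)) ?sumEFin ?lte_fin//.
    by move=> p _; rewrite lebesgue_box.
(* these cells cover the union *)
have sub : box a b `&` \bigcup_(k in `I_K) box (B k).1 (B k).2 `<=`
    \big[setU/set0]_(p in S) box (lo' p) (hi' p).
  move=> z [[az zb] [k /= kK Bz]].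
  have cell i : exists p : 'I_M,
      a ord0 i + eta * p%:R <= z ord0 i <= a ord0 i + eta * p.+1%:R.
    by apply: lattice_cell => //; exact: le_lt_trans (zb i) (bM i).
  have [p Hp] := choice cell.
  pose pf : {ffun 'I_n.+1 -> 'I_M} := [ffun i => p i].
  have zp : box (lo' pf) (hi' pf) z.
    have -> : z = clamp a b z by rewrite clamp_id.
    by split; apply: vle_clamp => i; rewrite !mxE ffunE; have /andP[] := Hp i.
  have pS : pf \in S.
    by rewrite inE; apply/asboolP; exists (Ordinal kK), z.
  by rewrite (bigD1 pf)//=; left.
apply: le_trans (le_outer_measure mu _ _ sub) _.
apply: le_trans (outer_measure_big_le _ _ _) _.
apply: (@le_trans _ _ (\sum_(p in S) (V (lo' p) (hi' p))%:E)%E).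
  by apply: lee_sum => p _; exact: muV.1.
rewrite sumEFin lee_fin; apply/ltW; apply: le_lt_trans SF.
apply: ler_sum => p _; rewrite clampedE//; [exact: clamp_ge|exact: clamp_le].
Qed.

End necessity_null.

(** * Density of an absolutely continuous increment *)

Section generated_outer.
Context {R : realType} {n : nat}.
Notation T := 'rV[R]_n.+1.
Variable V : T -> T -> R.
Hypothesis addV : box_additive V.
Local Open Scope ereal_scope.

Let discrete := g_sigma_algebraType [set: set T].

Let mdiscrete (A : set discrete) : measurable A.
Proof. exact: sub_sigma_algebra. Qed.

(** Infinite on unbounded sets, as an infimum over the empty set. *)
Let cost (X : set discrete) : \bar R := ereal_inf
  [set (V p.1 p.2)%:E | p in [set p : T * T | vle p.1 p.2 /\ X `<=` box p.1 p.2]].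

Let cost_ge0 X : 0 <= cost X.
Proof.
by apply: le_ereal_inf_tmp => _ [p [pp _] <-]; rewrite lee_fin addV.1.
Qed.

Let cost_le X c d : vle c d -> X `<=` box c d -> cost X <= (V c d)%:E.
Proof. by move=> cd Xcd; apply: ereal_inf_lbound; exists (c, d). Qed.

Let cost0 : cost set0 = 0.
Proof.
apply/eqP; rewrite eq_le cost_ge0 andbT.
have := @cost_le set0 0%R 0%R (@vle_refl _ _ _) (@sub0set _ _).
by rewrite (additive_degenerate addV (i := ord0)).
Qed.

(** An outer measure is built from a set function on a semiring of sets. Here the
    semiring is the discrete one, and the cost of a set is the least
    weight of a single rectangle that contains it, so that countable coverings by
    arbitrary sets amount to coverings by rectangles. *)
Lemma generated_outer_measure : exists mu : {outer_measure set T -> \bar R},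
  generated mu V.
Proof.
pose mu : {outer_measure set T -> \bar R} := HB.pack (mu_ext cost)
  (isOuterMeasure.Build R T (mu_ext cost) (mu_ext0 cost0 cost_ge0)
     (mu_ext_ge0 cost_ge0) (le_mu_ext cost) (mu_ext_sigma_subadditive cost_ge0)).
exists mu; split=> [c d cd|X r].
  apply: ereal_inf_le; exists (\sum_(k <oo) cost (if k == 0%N then box c d else set0)).
    exists (fun k => if k == 0%N then box c d else set0) => //.
    by split=> [k|x cdx]; [exact: mdiscrete|exists 0%N].
  rewrite nneseries_recl//=.
  rewrite eseries_cond/= eseries0 ?adde0//; first exact: cost_le.
  by move=> [//|k] _ _ /=; exact: cost0.
move=> /ereal_inf_lt[_ [A [mA XA] <-]] sr.
have s_fin : \sum_(k <oo) cost (A k) \is a fin_num.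
  rewrite ge0_fin_numE; first exact: lt_le_trans sr (leey _).
  exact: nneseries_ge0.
have [e e0 er] : exists2 e : R, (0 < e)%R & \sum_(k <oo) cost (A k) + e%:E < r.
  move: s_fin sr; case: (\sum_(k <oo) cost (A k)) => [s| |]// _.
  case: r => [r| |]//; last by move=> _; exists 1%R; rewrite // -EFinD ltry.
  rewrite lte_fin => sr; exists ((r - s) / 2)%R; first by lra.
  by rewrite -EFinD lte_fin; lra.
have cost_fin k : cost (A k) \is a fin_num.
  rewrite ge0_fin_numE//; apply: le_lt_trans (_ : \sum_(k <oo) cost (A k) < +oo).
    apply: le_trans (nneseries_lim_ge k.+1 _) => //.
    by rewrite big_mkord big_ord_recr/= leeDr// sume_ge0.
  by rewrite ltey_eq s_fin.
have /choice[B HB] : forall k, exists p : T * T, [/\ vle p.1 p.2,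
    A k `<=` box p.1 p.2 &
    (V p.1 p.2)%:E <= cost (A k) + (e / (2 ^ k.+1)%:R)%:E].
  move=> k.
  have ek : (0 < e / (2 ^ k.+1)%:R)%R by rewrite divr_gt0// ltr0n expn_gt0.
  have [_ [p [pp Ap] <-] /ltW lep] := lb_ereal_inf_adherent ek (cost_fin k).
  by exists p.
exists B.
  split=> [k|x /XA [k _ Akx]]; first by have [] := HB k.
  by exists k => //; have [_ + _] := HB k; exact.
apply: le_lt_trans er; apply: le_trans (epsilon_trick xpredT _ (ltW e0)).
  apply: lee_nneseries => [k _ _|k _]; last by have [] := HB k.
  by rewrite lee_fin addV.1//; have [] := HB k.
by [].
Qed.

End generated_outer.

Section density_exists.
Context {R : realType} {n : nat}.
Notation T := 'rV[R]_n.+1.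
Notation TL := (caratheodory_type (@lebesgue_outer R n)).
Notation L := (lebesgue_rV R n).
Variables (a b : T) (f : T -> R).
Hypotheses (ab : vle a b) (incf : jointly_increasing f a b)
  (acf : jointly_absolutely_continuous f a b).
Notation F := (joint_increment f).
Notation V := (clamped a b (joint_increment f)).
Local Open Scope ereal_scope.

(** A null set has coverings of volume less than any [del]; each finite union of
    covering rectangles is controlled by [finite_union_small], and continuity from
    below passes to the countable union. *)
Lemma generated_null (mu : {outer_measure set T -> \bar R}) (N : set T) :
  generated mu V -> N `<=` box a b -> lebesgue_outer N = 0 -> mu N = 0.
Proof.
move=> muV Nab N0; apply/eqP; rewrite eq_le outer_measure_ge0 andbT.
apply/lee_addgt0Pr => e e0; rewrite add0e.
have [del del0 acd] := acf e0.
have [|B [leB NB] Bdel] := (@lebesgue_generated R n).2 N del%:E.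
  by rewrite N0 lte_fin.
have mB k : measurable (box (B k).1 (B k).2 : set (caratheodory_type mu)).
  exact: (borel_caratheodory (additive_clamped_increment ab incf) muV (borel_box _ _)).
have mab : measurable (box a b : set (caratheodory_type mu)).
  exact: (borel_caratheodory (additive_clamped_increment ab incf) muV (borel_box _ _)).
pose W K : set (caratheodory_type mu) :=
  box a b `&` \bigcup_(k in `I_K) box (B k).1 (B k).2.
have mW K : measurable (W K).
  by apply: measurableI => //; apply: bigcup_measurable => k _; exact: mB.
have We K : mu (W K) <= e%:E.
  apply: (finite_union_small ab muV acd leB).
  rewrite -lte_fin; apply: le_lt_trans Bdel.
  rewrite -sumEFin; apply: le_trans (nneseries_lim_ge K _); last first.
    by move=> k _ _; rewrite lee_fin additive_box_volume.1.
  by rewrite big_mkord.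
have cvgW : (mu \o W) @ \oo --> mu (\bigcup_K W K).
  apply: nondecreasing_cvg_mu => //; first exact: bigcup_measurable.
  move=> i j ij; apply/subsetPset => x [abx [k /= ki Bx]]; split => //.
  by exists k => //=; exact: leq_trans ij.
apply: (@le_trans _ _ (mu (\bigcup_K W K))).
  apply: le_outer_measure => x Nx; have [k _ Bx] := NB x Nx.
  by exists k.+1 => //; split; [exact: Nab|exists k => /=].
rewrite -(cvg_lim _ cvgW)//; apply: lime_le; first by apply/cvg_ex; eexists; exact: cvgW.
by apply: nearW.
Qed.

(** Radon-Nikodym on the Borel sets, where both measures live; restriction to
    [[a, b]] makes the second one finite. The density is then transported along
    the identity, which is measurable from the Lebesgue measurable sets to the
    Borel sets. *)
Lemma density_exists : exists phi : T -> R,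
  [/\ measurable_fun (setT : set TL) phi, forall x, (0 <= phi x)%R,
    L.-integrable (setT : set TL) (EFin \o phi) &
    forall c d, vle a c -> vle c d -> vle d b ->
      \int[L]_(x in box c d) (phi x)%:E = (F c d)%:E].
Proof.
have addV := additive_clamped_increment ab incf.
have [mu muV] := generated_outer_measure addV.
have mu_m (A : set borel) : measurable A ->
    measurable (A : set (caratheodory_type mu)) by exact: (borel_caratheodory addV muV).
pose lam0 : set (@borel R n) -> \bar R := @lebesgue_outer R n.
have lam0_sigma : semi_sigma_additive lam0.
  move=> A mA tA mUA.
  exact: (@measure_semi_sigma_additive _ _ _ L A
    (fun k => borel_lebesgue (mA k)) tA (borel_lebesgue mUA)).
have lam0_sf : sigma_finite setT lam0.
  exists (fun k : nat => box (const_mx (- k%:R)%R : T) (const_mx k%:R%R : T)).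
    apply/seteqP; split => // x _.
    pose k := (\sum_i Num.bound `|x ord0 i|)%N.
    have xk i : (`|x ord0 i| <= k%:R)%R.
      apply/ltW; apply: lt_le_trans (archi_boundP _) _ => //.
      by rewrite ler_nat /k (bigD1 i)//= leq_addr.
    by exists k => //; split=> i; rewrite mxE; have := xk i; rewrite ler_norml => /andP[].
  move=> k; split; first exact: borel_box.
  have le : vle (const_mx (- k%:R)%R : T) (const_mx k%:R%R : T).
    by move=> i; rewrite !mxE; have : (0 <= k%:R :> R)%R by []; lra.
  by rewrite [X in X < _](lebesgue_box le) ltry.
pose lam1 : {measure set borel -> \bar R} := HB.pack lam0 (isMeasure.Build _ _ _
  lam0 (@lebesgue_outer0 R n) (@lebesgue_outer_ge0 R n) lam0_sigma).
pose lam : {sigma_finite_measure set borel -> \bar R} := HB.pack (Measure.sort lam1)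
  (Measure_isSigmaFinite.Build _ _ _ (Measure.sort lam1) lam0_sf).
pose nu0 (A : set (@borel R n)) := mu (A `&` box a b).
have nu0_0 : nu0 set0 = 0 by rewrite /nu0 set0I outer_measure0.
have nu0_ge0 A : 0 <= nu0 A by exact: outer_measure_ge0.
have nu0_sigma : semi_sigma_additive nu0.
  move=> A mA tA mUA.
  have mab : measurable (box a b : set (caratheodory_type mu)) := mu_m _ (borel_box _ _).
  exact: (@measure_semi_sigma_additive _ _ _ (mrestr (mu : set (caratheodory_type mu) -> _) mab) A
    (fun k => mu_m _ (mA k)) tA (mu_m _ mUA)).
have nu0_fin : fin_num_fun nu0.
  move=> A mA; rewrite ge0_fin_numE//.
  apply: (@le_lt_trans _ _ (V a b)%:E); last exact: ltry.
  by apply: le_trans (muV.1 _ _ ab); exact: le_outer_measure.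
pose nu1 : {measure set borel -> \bar R} :=
  HB.pack nu0 (isMeasure.Build _ _ _ nu0 nu0_0 nu0_ge0 nu0_sigma).
pose nu : {finite_measure set borel -> \bar R} := HB.pack (Measure.sort nu1)
  (Measure_isFinite.Build _ _ _ (Measure.sort nu1) nu0_fin).
have nulam : nu `<< lam.
  apply/null_content_dominatesP => A mA A0; apply: (generated_null muV) => //.
  apply/eqP; rewrite eq_le lebesgue_outer_ge0 andbT -A0.
  by apply: le_lebesgue_outer => x [].
have [phi [phi0 phifin intphi phiE]] := radon_nikodym_sigma_finite nulam.
have mid : measurable_fun [set: TL] (id : TL -> borel).
  by move=> _ A mA; rewrite setTI; exact: borel_lebesgue.
have mphi : measurable_fun [set: borel] phi by have /integrableP[] := intphi.
have push (D : set borel) : measurable D ->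
    \int[lam]_(x in D) phi x = \int[L]_(x in D) phi x.
  move=> mD; have := @ge0_integral_pushforward _ _ _ _ _ _ mid L D phi mD.
  by apply; [exact: measurable_funS mphi|move=> x _].
have mphiL : measurable_fun [set: TL] phi.
  by apply: (measurableT_comp mphi mid).
exists (fine \o phi); split.
- exact: measurableT_comp.
- by move=> x; rewrite fine_ge0.
- apply/integrableP; split.
    by apply/measurable_EFinP; exact: measurableT_comp.
  have /integrableP[_] := intphi.
  rewrite (eq_integral phi) => [|x _]; last by rewrite gee0_abs.
  rewrite push// => phioo; rewrite (eq_integral (phi : TL -> \bar R))// => x _ /=.
  by rewrite ger0_norm ?fine_ge0// fineK.
- move=> c d ac cd db.
  have cb := vle_trans cd db; have ad := vle_trans ac cd.
  rewrite (eq_integral (phi : TL -> \bar R)); last by move=> x _ /=; rewrite fineK.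
  rewrite -push; last exact: borel_box.
  rewrite -phiE; last exact: borel_box.
  rewrite /nu/= /nu0 (setIidl _).
    rewrite (generated_box addV muV)//; first by rewrite clampedE.
    exact: vol_continuous_clamped_increment.
  by move=> x [cx xd]; split; [exact: vle_trans cx|exact: vle_trans db].
Qed.

End density_exists.

(** * Points of zero density *)

Lemma seq_max (R : realType) (I : eqType) (rad : I -> R) (i0 : I) (s : seq I) :
  exists2 m, m \in i0 :: s & forall i, i \in i0 :: s -> rad i <= rad m.
Proof.
elim: s i0 => [|j s ih] i0.
  by exists i0; [rewrite mem_head|move=> i; rewrite inE => /eqP ->].
have [m ms mP] := ih j; have [mi|im] := leP (rad m) (rad i0).
  exists i0; first by rewrite mem_head.
  move=> i; rewrite inE => /orP[/eqP ->//|/mP]; move/le_trans; exact.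
exists m; first by rewrite inE ms orbT.
by move=> i; rewrite inE => /orP[/eqP ->|/mP//]; exact: ltW.
Qed.

(** Greedy selection: keep a set of greatest radius, discard those that meet
    it, and repeat. *)
Lemma vitali_finite (R : realType) (T : Type) (I : eqType) (Q : I -> set T)
    (rad : I -> R) (s : seq I) : uniq s -> (forall i, i \in s -> Q i !=set0) ->
  exists D : seq I, [/\ uniq D, {subset D <= s}, trivIset [set` D] Q &
    forall i, i \in s -> exists2 j, j \in D & Q i `&` Q j !=set0 /\ rad i <= rad j].
Proof.
have [k] := ubnP (size s); elim: k s => // k ih [|i0 s] sk us Q0.
  by exists [::]; split.
have [m ms mP] := seq_max rad i0 s.
pose s' := [seq i <- i0 :: s | `[< Q i `&` Q m = set0 >]].
have Qm : Q m `&` Q m <> set0 by have [x Qx] := Q0 _ ms; move/seteqP => [/(_ x)] []; split.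
have s's : (size s' < k)%N.
  rewrite -ltnS (leq_ltn_trans _ sk)// size_filter -(count_predC (fun i => `[< Q i `&` Q m = set0 >]) (i0 :: s)).
  rewrite -addn1 leq_add2l -has_count; apply/hasP; exists m => //=.
  by apply/asboolPn.
have [|i|D [uD Ds tD DP]] := ih s' s's; first exact: filter_uniq.
  by rewrite mem_filter => /andP[_]; exact: Q0.
exists (m :: D); split.
- rewrite /= uD andbT; apply/negP => /Ds; rewrite mem_filter => /andP[/asboolP].
  by move/Qm.
- by move=> i; rewrite inE => /orP[/eqP ->//|/Ds]; rewrite mem_filter => /andP[].
- have Dm i : i \in D -> Q i `&` Q m = set0.
    by move=> /Ds; rewrite mem_filter => /andP[/asboolP].
  apply/trivIsetP => i j /=; rewrite !inE => /orP[/eqP ->|iD] /orP[/eqP ->|jD].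
  + by rewrite eqxx.
  + by rewrite setIC => _; exact: Dm.
  + by move=> _; exact: Dm.
  + by move/trivIsetP : tD => tD; exact: tD.
- move=> i is_; have [im|im] := pselect (Q i `&` Q m = set0).
    have [|j jD ij] := DP i.
      by rewrite mem_filter is_ andbT; apply/asboolP.
    by exists j => //; rewrite inE jD orbT.
  exists m; first by rewrite mem_head.
  by split; [exact/set0P/eqP|exact: mP].
Qed.

Section differentiation_null.
Context {R : realType} {n : nat}.
Notation T := 'rV[R]_n.+1.
Notation TL := (caratheodory_type (@lebesgue_outer R n)).
Notation L := (lebesgue_rV R n).
Variables (a b : T).
Hypothesis ab : vle a b.

Definition cube (c : T) (s : R) : set T := obox (c - const_mx s) (c + const_mx s).

Lemma cubeP (c : T) (s : R) (x : T) :
  cube c s x <-> forall i, `|x ord0 i - c ord0 i| < s.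
Proof.
by split=> H i; have := H i; rewrite !mxE ltr_norml => /andP[? ?]; apply/andP; split; lra.
Qed.

Section zero_density.
Variables (psi : T -> R) (A : set TL) (r : R).
Hypotheses (mpsi : measurable_fun (setT : set TL) psi)
  (psi0 : forall x, 0 <= psi x)
  (intpsi : L.-integrable (setT : set TL) (EFin \o psi))
  (mA : measurable A) (Aab : A `<=` box a b) (psiA : forall x, A x -> psi x = 0)
  (r0 : 0 < r).
Notation K X := (\int[L]_(x in X) (psi x)%:E)%E.

Let mpsiE (D : set TL) : measurable_fun D (fun x => (psi x)%:E).
Proof. by apply/measurable_EFinP; exact: measurable_funS mpsi. Qed.

Let K_mono (X Y : set TL) : measurable X -> measurable Y -> X `<=` Y -> (K X <= K Y)%E.
Proof.
move=> mX mY XY; apply: ge0_subset_integral => //.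
by move=> x _; rewrite lee_fin.
Qed.

(** Outer regularity of Lebesgue measure gives an open set slightly larger than
    [A]; the integral over the difference is small by absolute continuity. *)
Let open_hull (e : R) : 0 < e -> exists B : nat -> T * T,
  A `<=` \bigcup_k obox (B k).1 (B k).2 /\
  (K (\bigcup_k obox (B k).1 (B k).2) < e%:E)%E.
Proof.
move=> e0; have [del del0 Hdel] := @integral_small _ TL R L psi e psi0 intpsi e0.
have Afin : L A \is a fin_num.
  rewrite ge0_fin_numE; last exact: lebesgue_outer_ge0.
  apply: le_lt_trans (le_lebesgue_outer Aab) _.
  by rewrite [X in (X < _)%E](lebesgue_box ab) ltry.
have [|B AB BA] := (@lebesgue_generated R n).2 A (L A + (del / 2)%:E)%E.
  by rewrite [X in (X < _)%E](_ : _ = L A)// lteDl// lte_fin divr_gt0.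
have d20 : 0 < del / 2 by rewrite divr_gt0.
have [B' [leB' AB' B'B]] := expand_cover additive_box_volume
  (@vol_continuous_box_volume R n) AB d20.
exists B'; split => //.
set U := \bigcup_k obox (B' k).1 (B' k).2.
have mO k : measurable (obox (B' k).1 (B' k).2 : set TL).
  exact: borel_lebesgue (borel_obox _ _).
have mU : measurable (U : set TL) by exact: bigcup_measurable.
have LU : (L U < L A + del%:E)%E.
  apply: (@le_lt_trans _ _ (\sum_(k <oo) (box_volume (B' k).1 (B' k).2)%:E)%E).
    apply: le_trans (lebesgue_outer_sigma_subadditive _) _.
    apply: lee_nneseries => [k _ _|k _]; first exact: lebesgue_outer_ge0.
    by rewrite [X in (X <= _)%E](lebesgue_obox (leB' k)).
  apply: le_lt_trans B'B _.
  have -> : (L A + del%:E = L A + (del / 2)%:E + (del / 2)%:E)%E.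
    by rewrite -addeA -EFinD -splitr.
  by rewrite lteD2rE.
have LUA : (L (U `\` A) < del%:E)%E.
  have : (L (U `\` A) + L A < L A + del%:E)%E.
    apply: le_lt_trans LU; rewrite addeC.
    rewrite -[X in (_ <= L X)%E](setDUK AB').
    rewrite [leRHS](measureU L)//; first exact: measurableD.
    by rewrite setDE setICA setICr setI0.
  by rewrite addeC lteD2lE.
have -> : K U = K (U `\` A).
  have AU : A `<=` U := AB'.
  rewrite -{1}(setDUK AU) ge0_integral_setU//.
  - rewrite [X in (X + _)%E](_ : _ = 0%E) ?add0e//.
    by apply: integral0_eq => x Ax; rewrite psiA.
  - exact: measurableD.
  - by move=> x _; rewrite lee_fin.
  - by apply/eqP; rewrite setDE setICA setICr setI0.
by apply: Hdel => //; exact: measurableD.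
Qed.

(** If two cubes meet, the one of smaller radius lies in the other enlarged three
    times, whose side is then six times its radius. *)
Let cube_vitali (U : set TL) (e : R) (I : choiceType) (c : I -> T) (s : I -> R) (q : seq I) :
  measurable U -> (K U <= e%:E)%E -> uniq q ->
  (forall i, i \in q -> [/\ 0 < s i, cube (c i) (s i) `<=` U &
     ((r * (s i / 3) ^+ n.+1)%:E <= K (cube (c i) (s i)))%E]) ->
  (lebesgue_outer (\bigcup_(i in [set` q]) cube (c i) (s i)) <= (18 ^+ n.+1 * e / r)%:E)%E.
Proof.
move=> mU KU uq qP.
have [i iq|D [uD Dq tD DP]] := vitali_finite s uq (Q := fun i => cube (c i) (s i)).
  have [si _ _] := qP i iq; exists (c i); apply/cubeP => j.
  by rewrite subrr normr0.
have mC i : measurable (cube (c i) (s i) : set TL).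
  exact: borel_lebesgue (borel_obox _ _).
have sub : \bigcup_(i in [set` q]) cube (c i) (s i) `<=`
    \big[setU/set0]_(j <- D) box (c j - const_mx (3 * s j)) (c j + const_mx (3 * s j)).
  move=> x [i /= iq /cubeP ix]; have [j jD [[y [/cubeP yi /cubeP yj]] sij]] := DP i iq.
  rewrite -bigcup_seq; exists j => //=; split=> k; rewrite !mxE;
  have := ix k; have := yi k; have := yj k; rewrite !ltr_norml;
  by move=> /andP[? ?] /andP[? ?] /andP[? ?]; lra.
apply: le_trans (le_lebesgue_outer sub) _.
apply: (@le_trans _ _ (\sum_(j <- D) ((6 * s j) ^+ n.+1)%:E)%E).
  elim: (D) Dq {uD tD DP sub} => [|j D' ih] Dq.
    by rewrite !big_nil lebesgue_outer0.
  rewrite !big_cons; apply: le_trans (outer_measureU2 (@lebesgue_outer R n) _ _) _.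
  apply: leeD; last by apply: ih => k kD; apply: Dq; rewrite inE kD orbT.
  have [sj _ _] := qP j (Dq j (mem_head _ _)).
  have le : vle (c j - const_mx (3 * s j)) (c j + const_mx (3 * s j)).
    by move=> k; rewrite !mxE; lra.
  rewrite [X in (X <= _)%E](lebesgue_box le) lee_fin /box_volume.
  rewrite (eq_bigr (fun=> 6 * s j)) ?prodr_const ?card_ord//.
  by move=> k _; rewrite !mxE; lra.
apply: (@le_trans _ _ ((18 ^+ n.+1 / r)%:E * \sum_(j <- D) K (cube (c j) (s j)))%E).
  rewrite ge0_sume_distrr; last by move=> j _; apply: integral_ge0 => x _; rewrite lee_fin.
  rewrite big_seq [leRHS]big_seq; apply: lee_sum => j /Dq/qP[sj _ rK].
  apply: le_trans (_ : ((18 ^+ n.+1 / r)%:E * (r * (s j / 3) ^+ n.+1)%:E)%E <= _)%E.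
    rewrite -EFinM lee_fin mulrA divfK ?gt_eqF// -exprMn.
    by rewrite le_eqVlt; apply/orP; left; apply/eqP; congr (_ ^+ _); lra.
  by apply: lee_wpmul2l => //; rewrite lee_fin divr_ge0 ?exprn_ge0// ltW.
rewrite -(@ge0_integral_bigsetU _ TL R L I (fun i => cube (c i) (s i))
  (fun x => (psi x)%:E) D mC uD tD)//; last by move=> x _; rewrite lee_fin.
apply: le_trans (_ : ((18 ^+ n.+1 / r)%:E * e%:E)%E <= _)%E; last first.
  by rewrite -EFinM lee_fin mulrAC.
apply: lee_wpmul2l; first by rewrite lee_fin divr_ge0 ?exprn_ge0// ltW.
apply: le_trans KU; apply: K_mono => //; first exact: bigsetU_measurable.
rewrite -bigcup_seq => x [j /= /Dq/qP[_ + _]]; exact.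
Qed.

(** At almost every point of a set on which [psi] vanishes, the mean of [psi]
    over small one-sided cubes is at most [r]. Since [psi] has a small integral [e]
    over a suitable open set [U] containing [A], and each exceptional point lies in
    an open cube inside [U] of volume at most a constant times the integral of
    [psi] over this cube divided by [r], the covering argument bounds the measure
    of the exceptional set by a constant times [e / r]. Cubes with rational centres
    and radii suffice, and they form a countable family. *)
Lemma zero_density : lebesgue_outer [set x | A x /\ forall h0, 0 < h0 ->
  exists2 h, 0 < h < h0 & ((r * h ^+ n.+1)%:E < K (box x (x + const_mx h)))%E] = 0%E.
Proof.
set E := [set x | _].
apply/eqP; rewrite eq_le lebesgue_outer_ge0 andbT.
apply/lee_addgt0Pr => e0 e00; rewrite add0e.
pose e := e0 * r / 18 ^+ n.+1.
have p18 : 0 < 18 ^+ n.+1 :> R by exact: exprn_gt0.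
have e_gt0 : 0 < e by rewrite divr_gt0// mulr_gt0.
have [B [AB KU]] := open_hull e_gt0.
set U := \bigcup_k obox (B k).1 (B k).2 in AB KU.
have mU : measurable (U : set TL).
  by apply: bigcup_measurable => k _; exact: borel_lebesgue (borel_obox _ _).
pose I := ('rV[rat]_n.+1 * rat)%type.
pose c (q : I) : T := map_mx ratr q.1.
pose s (q : I) : R := ratr q.2.
pose good (q : I) := `[< [/\ 0 < s q, cube (c q) (s q) `<=` U &
     ((r * (s q / 3) ^+ n.+1)%:E <= K (cube (c q) (s q)))%E] >].
pose ql k := [seq q <- undup (pmap unpickle (iota 0 k)) | good q].
pose W k := \bigcup_(q in [set` ql k]) cube (c q) (s q).
have mC q : measurable (cube (c q) (s q) : set TL).
  exact: borel_lebesgue (borel_obox _ _).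
have We k : (lebesgue_outer (W k) <= e0%:E)%E.
  have -> : e0 = 18 ^+ n.+1 * e / r.
    by rewrite /e; field; rewrite !gt_eqF.
  apply: (cube_vitali mU (ltW KU)).
    by apply: filter_uniq; exact: undup_uniq.
  by move=> q; rewrite mem_filter => /andP[/asboolP].
have mW k : measurable (W k : set TL).
  rewrite /W bigcup_seq; apply: bigsetU_measurable => q _; exact: mC.
have cvgW : (L \o W) @ \oo --> L (\bigcup_k W k).
  apply: nondecreasing_cvg_mu => //; first exact: bigcup_measurable.
  move=> k l kl; apply/subsetPset => x [q /= qk xq]; exists q => //=.
  move: qk; rewrite !mem_filter !mem_undup => /andP[-> /=].
  rewrite !mem_pmap => /mapP[m + ->]; rewrite mem_iota => mk.
  by apply: map_f; rewrite mem_iota/= add0n (leq_trans _ kl)//; case/andP: mk.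
apply: (@le_trans _ _ (L (\bigcup_k W k))); last first.
  rewrite -(cvg_lim _ cvgW)//; apply: lime_le; first by apply/cvg_ex; eexists; exact: cvgW.
  by apply: nearW => k; exact: We.
apply: le_lebesgue_outer => x [Ax xE].
have [k _ Bkx] := AB x Ax.
have [m m0 Hm] := @fin_lower R 'I_n.+1
  (fun i => Num.min (x ord0 i - (B k).1 ord0 i) ((B k).2 ord0 i - x ord0 i)) ltac:(
    by move=> i; have /andP[? ?] := Bkx i; rewrite lt_min !subr_gt0; apply/andP).
have [|h /andP[h0 hm] Kh] := xE (m / 4); first by rewrite divr_gt0.
(* a rational cube that contains [x, x + h] and has comparable size *)
have [s0 s0P] : exists s0 : rat, 2 * h < ratr s0 < 3 * h.
  have [|s0] := @rat_in_itvoo R (2 * h) (3 * h); first by lra.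
  by rewrite in_itv/= => s0P; exists s0.
have /choice[c0 c0P] : forall i, exists q : rat, x ord0 i - h < ratr q < x ord0 i + h.
  move=> i; have [|q] := @rat_in_itvoo R (x ord0 i - h) (x ord0 i + h); first by lra.
  by rewrite in_itv/= => qP; exists q.
pose q : I := (\row_i c0 i, s0).
have cq i : c q ord0 i = ratr (c0 i) by rewrite !mxE.
have gq : good q.
  apply/asboolP; split.
  - by rewrite /s/=; case/andP: s0P => ? ?; lra.
  - move=> y /cubeP yq; exists k => // i.
    have := yq i; have := Hm i; have := c0P i; rewrite cq /s/= ltr_norml le_min.
    by case/andP: s0P => ? ? /andP[? ?] /andP[? ?] /andP[? ?]; apply/andP; split; lra.
  - apply: le_trans (_ : (r * h ^+ n.+1)%:E <= _)%E.
      rewrite lee_fin ler_pM2l// lerXn2r ?nnegrE//.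
      + by rewrite /s/=; case/andP: s0P => ? ?; rewrite divr_ge0//; lra.
      + exact: ltW.
      + by rewrite /s/= ler_pdivrMr//; case/andP: s0P => ? ?; lra.
    apply: le_trans (ltW Kh) _; apply: K_mono => //.
      exact: borel_lebesgue (borel_box _ _).
    move=> y [xy yx]; apply/cubeP => i; have := xy i; have := yx i; have := c0P i.
    rewrite cq !mxE /s/= ltr_norml => /andP[? ?] ? ?; case/andP: s0P => ? ?.
    by apply/andP; split; lra.
exists (pickle q).+1 => //; exists q.
  rewrite /= mem_filter gq mem_undup mem_pmap; apply/mapP; exists (pickle q).
    by rewrite mem_iota /= add0n.
  by rewrite pickleK.
apply/cubeP => i; have := c0P i; rewrite cq ltr_norml /s/= => /andP[? ?].
by case/andP: s0P => ? ?; apply/andP; split; lra.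
Qed.

End zero_density.
End differentiation_null.

(** * Differentiation along one-sided cubes *)

Section differentiation.
Context {R : realType} {n : nat}.
Notation T := 'rV[R]_n.+1.
Notation TL := (caratheodory_type (@lebesgue_outer R n)).
Notation L := (lebesgue_rV R n).
Variables (a b : T) (phi : T -> R).
Hypotheses (ab : vle a b) (mphi : measurable_fun (setT : set TL) phi)
  (phi0 : forall x, 0 <= phi x)
  (intphi : L.-integrable (setT : set TL) (EFin \o phi)).

(** The points of [A] at which the means of [psi] over [[x, x + h]] exceed [r] for
    arbitrarily small [h]. *)
Let bad (psi : T -> R) (A : set T) (r : R) : set T :=
  [set x | A x /\ forall h0, 0 < h0 -> exists2 h, 0 < h < h0 &
    ((r * h ^+ n.+1)%:E < \int[L]_(y in box x (x + const_mx h)) (psi y)%:E)%E].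

Let mab : measurable (box a b : set TL). Proof. exact: borel_lebesgue (borel_box _ _). Qed.

Let mpre_lt (s : R) : measurable (box a b `&` [set x | phi x < s] : set TL).
Proof.
by have := mphi measurableT (measurable_itv `]-oo, s[); rewrite setTI => H;
  apply: measurableI => //; rewrite set_itvE in H.
Qed.

Let mpre_gt (s : R) : measurable (box a b `&` [set x | s < phi x] : set TL).
Proof.
by have := mphi measurableT (measurable_itv `]s, +oo[); rewrite setTI => H;
  apply: measurableI => //; rewrite set_itvE in H.
Qed.

(** [phi] is at most [s + above s], and at least [s * (1 - below s)], within
    [[a, b]]; the corrections vanish where [phi < s], respectively where
    [s < phi]. *)
Let above s x := phi x * \1_(~` (box a b `&` [set x | phi x < s])) x.
Let below s x : R := \1_(box a b `\` (box a b `&` [set x | s < phi x])) x.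

Let mabove s : measurable_fun (setT : set TL) (above s).
Proof.
have mI : measurable_fun (setT : set TL)
    (\1_(~` (box a b `&` [set x | phi x < s])) : TL -> R).
  by apply: measurable_indic; exact: measurableC.
exact: (measurable_funM mphi mI).
Qed.

Let mbelow s : measurable_fun (setT : set TL) (below s).
Proof. by apply: measurable_indic; exact: measurableD. Qed.

Let above0 s x : 0 <= above s x.
Proof. by rewrite mulr_ge0// indicE ler0n. Qed.

Let below0 s x : 0 <= below s x.
Proof. by rewrite /below indicE ler0n. Qed.

Let intabove s : L.-integrable (setT : set TL) (EFin \o above s).
Proof.
have H1 : measurable_fun (setT : set TL) (EFin \o above s).
  by apply/measurable_EFinP; exact: mabove.
have H2 (x : TL) : [set: TL] x -> (`|(EFin \o above s) x| <= `|(EFin \o phi) x|)%E.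
  move=> _; rewrite /= lee_fin !ger0_norm// /above indicE.
  by case: (_ \in _); rewrite ?mulr1// mulr0.
exact: (le_integrable measurableT H1 H2 intphi).
Qed.

Let intbelow s : L.-integrable (setT : set TL) (EFin \o below s).
Proof.
have mD : measurable (box a b `\` (box a b `&` [set x | s < phi x]) : set TL).
  exact: measurableD.
apply/integrableP; split; first by apply/measurable_EFinP; exact: mbelow.
rewrite (eq_integral (fun x : TL => (\1_(box a b `\` (box a b `&` [set x | s < phi x])) x)%:E)).
  rewrite integral_indic// setIT; apply: le_lt_trans (ltry (box_volume a b)).
  rewrite -(lebesgue_box ab); apply: le_lebesgue_outer; exact: subDsetl.
by move=> x _ /=; rewrite ger0_norm.
Qed.

Lemma bad_above s r : 0 < r ->
  lebesgue_outer (bad (above s) (box a b `&` [set x | phi x < s]) r) = 0%E.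
Proof.
move=> r0; apply: (zero_density ab (mabove s) (above0 s) (intabove s) (mpre_lt s) _ _ r0).
  by move=> x [].
move=> x Ax; rewrite /above indicE memNset ?mulr0//; exact.
Qed.

Lemma bad_below s r : 0 < r ->
  lebesgue_outer (bad (below s) (box a b `&` [set x | s < phi x]) r) = 0%E.
Proof.
move=> r0; apply: (zero_density ab (mbelow s) (below0 s) (intbelow s) (mpre_gt s) _ _ r0).
  by move=> x [].
by move=> x Ax; rewrite /below indicE memNset// => -[_].
Qed.

(** Outside the exceptional sets of [zero_density] for all rational levels [s]
    and bounds [r], levels just above and just below [phi x] squeeze the means of
    [phi] over small cubes. *)
Lemma differentiation : exists2 N : set T, lebesgue_outer N = 0%E &
  forall x, obox a b x -> ~ N x -> forall e, 0 < e ->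
  exists2 h0, 0 < h0 & forall h, 0 < h < h0 ->
   ((((phi x - e) * h ^+ n.+1)%:E <= \int[L]_(y in box x (x + const_mx h)) (phi y)%:E)%E
   /\ (\int[L]_(y in box x (x + const_mx h)) (phi y)%:E <= ((phi x + e) * h ^+ n.+1)%:E)%E).
Proof.
pose N1 (q : rat * rat) : set T := if 0 < ratr q.2 :> R then
  bad (above (ratr q.1)) (box a b `&` [set x | phi x < ratr q.1]) (ratr q.2) `|`
  bad (below (ratr q.1)) (box a b `&` [set x | ratr q.1 < phi x]) (ratr q.2)
  else set0.
have N10 q : lebesgue_outer (N1 q) = 0%E.
  rewrite /N1; case: ifPn => [q0|_]; last exact: lebesgue_outer0.
  apply/eqP; rewrite eq_le lebesgue_outer_ge0 andbT.
  apply: le_trans (outer_measureU2 (@lebesgue_outer R n) _ _) _.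
  have -> : (0 = 0 + 0 :> \bar R)%E by rewrite adde0.
  apply: leeD.
    by rewrite [X in (X <= _)%E](bad_above _ q0).
  by rewrite [X in (X <= _)%E](bad_below _ q0).
pose N := \bigcup_k (if unpickle k is Some q then N1 q else set0).
exists N.
  apply/eqP; rewrite eq_le lebesgue_outer_ge0 andbT.
  apply: le_trans (lebesgue_outer_sigma_subadditive _) _.
  rewrite eseries0// => k _ _; case: (unpickle k) => [q|]; first exact: N10.
  exact: lebesgue_outer0.
move=> x Ox nNx e e0.
have abx := obox_box Ox.
have nN1 (q : rat * rat) : ~ N1 q x.
  move=> Nqx; apply: nNx; exists (pickle q); first exact: I.
  rewrite pickleK; exact: Nqx.
have good s r : 0 < ratr r :> R -> phi x < ratr s :> R ->
    exists2 h0 : R, 0 < h0 & forall h, 0 < h < h0 ->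
    (\int[L]_(y in box x (x + const_mx h)) (above (ratr s) y)%:E <= (ratr r * h ^+ n.+1)%:E)%E.
  move=> r0 xs; apply: contrapT => H; apply: (nN1 (s, r)).
  rewrite /N1/= r0; left; split => // h0 h00; apply: contrapT => H2; apply: H.
  exists h0 => // h hh; rewrite leNgt; apply/negP => H3; apply: H2.
  by exists h.
have good2 s r : 0 < ratr r :> R -> ratr s < phi x :> R ->
    exists2 h0 : R, 0 < h0 & forall h, 0 < h < h0 ->
    (\int[L]_(y in box x (x + const_mx h)) (below (ratr s) y)%:E <= (ratr r * h ^+ n.+1)%:E)%E.
  move=> r0 xs; apply: contrapT => H; apply: (nN1 (s, r)).
  rewrite /N1/= r0; right; split => // h0 h00; apply: contrapT => H2; apply: H.
  exists h0 => // h hh; rewrite leNgt; apply/negP => H3; apply: H2.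
  by exists h.
have mQ h : measurable (box x (x + const_mx h) : set TL).
  exact: borel_lebesgue (borel_box _ _).
have LQ h : 0 < h -> (L (box x (x + const_mx h)) = (h ^+ n.+1)%:E)%E.
  move=> h0; rewrite lebesgue_box; last by move=> i; rewrite !mxE; lra.
  congr EFin; rewrite /box_volume (eq_bigr (fun=> h)) ?prodr_const ?card_ord//.
  by move=> i _; rewrite !mxE; lra.
have intC h (s : R) : 0 < h -> 0 <= s ->
    (\int[L]_(y in box x (x + const_mx h)) s%:E = (s * h ^+ n.+1)%:E)%E.
  move=> h0 s0; rewrite integral_cst// EFinM; congr (_ * _)%E; exact: LQ.
have mE (g : T -> R) (D : set TL) : measurable_fun (setT : set TL) g ->
    measurable_fun D (fun x => (g x)%:E).
  by move=> mg; apply/measurable_EFinP; exact: measurable_funS mg.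
(* from phi <= s + above s, with phi x < s < phi x + e / 2 *)
have [h1 h10 H1] : exists2 h0, 0 < h0 & forall h, 0 < h < h0 ->
    (\int[L]_(y in box x (x + const_mx h)) (phi y)%:E <= ((phi x + e) * h ^+ n.+1)%:E)%E.
  have [|s] := @rat_in_itvoo R (phi x) (phi x + e / 2); first by lra.
  rewrite in_itv/= => /andP[xs se].
  have [|r] := @rat_in_itvoo R 0 (e / 2); first by lra.
  rewrite in_itv/= => /andP[r0 re].
  have [h1 h10 H1] := good s r r0 xs.
  have [h2 h20 H2] := small_cube_sub Ox.
  exists (Num.min h1 h2); first by rewrite lt_min h10.
  move=> h /andP[h0]; rewrite lt_min => /andP[hh1 hh2].
  have s0 : 0 <= ratr s :> R by apply: le_trans (ltW xs).
  have xhb : vle (x + const_mx h) b by apply: H2; rewrite h0.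
  have Ks := H1 h; rewrite h0 hh1 in Ks; have {}Ks := Ks isT.
  apply: (@le_trans _ _ (\int[L]_(y in box x (x + const_mx h))
      ((ratr s)%:E + (above (ratr s) y)%:E))%E).
    apply: integral_mono => y [xy yx]; first by rewrite lee_fin.
    rewrite -EFinD lee_fin.
    have yab : box a b y.
      by split; [apply: vle_trans xy; case: abx|apply: vle_trans yx xhb].
    rewrite /above indicE.
    have [ys|sy] := ltP (phi y) (ratr s).
      by rewrite memNset ?mulr0 ?addr0; [exact: ltW|move=> /(_ (conj yab ys))].
    rewrite mem_set ?mulr1; first by rewrite lerDr.
    by move=> [_ /=]; rewrite ltNge sy.
  have P1 (y : TL) : box x (x + const_mx h) y -> (0 <= (ratr s)%:E :> \bar R)%E.
    by rewrite lee_fin.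
  have P2 (y : TL) : box x (x + const_mx h) y -> (0 <= (above (ratr s) y)%:E)%E.
    by rewrite lee_fin.
  have M1 : measurable_fun (box x (x + const_mx h) : set TL)
      (fun=> (ratr s)%:E : \bar R) by exact: measurable_cst.
  have M2 := mE _ (box x (x + const_mx h)) (mabove (ratr s)).
  rewrite (ge0_integralD L (mQ h) P1 M1 P2 M2).
  rewrite intC//; apply: le_trans (leeD (lexx _) Ks) _.
  rewrite -EFinD lee_fin -mulrDl ler_pM2r ?exprn_gt0//; lra.
(* from t <= phi + t * below t, with phi x - e / 2 < t < phi x *)
have [h2 h20 H2] : exists2 h0, 0 < h0 & forall h, 0 < h < h0 ->
    (((phi x - e) * h ^+ n.+1)%:E <= \int[L]_(y in box x (x + const_mx h)) (phi y)%:E)%E.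
  have [xe|ex] := leP (phi x) e.
    exists 1 => // h /andP[h0 _]; apply: (@le_trans _ _ 0%E).
      rewrite lee_fin mulr_le0_ge0 ?exprn_ge0 ?(ltW h0)//; lra.
    by apply: integral_ge0 => y _; rewrite lee_fin.
  have [|t] := @rat_in_itvoo R (phi x - e / 2) (phi x); first by lra.
  rewrite in_itv/= => /andP[et tx].
  have t0 : 0 < ratr t :> R by lra.
  have [|r] := @rat_in_itvoo R 0 (e / (2 * ratr t)).
    by rewrite divr_gt0// mulr_gt0.
  rewrite in_itv/= => /andP[r0].
  have t20 : 0 < 2 * ratr t :> R by apply: mulr_gt0.
  rewrite (ltr_pdivlMr _ _ t20) => rte.
  have [h1' h10' H1'] := good2 t r r0 tx.
  have [h2 h20 H2] := small_cube_sub Ox.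
  exists (Num.min h1 (Num.min h1' h2)); first by rewrite !lt_min h10 h10'.
  move=> h /andP[h0]; rewrite !lt_min => /and3P[hh hh1 hh2].
  have xhb : vle (x + const_mx h) b by apply: H2; rewrite h0.
  have Ks := H1' h; rewrite h0 hh1 in Ks; have {}Ks := Ks isT.
  have key : ((ratr t * h ^+ n.+1)%:E <= \int[L]_(y in box x (x + const_mx h)) (phi y)%:E +
     (ratr t)%:E * \int[L]_(y in box x (x + const_mx h)) (below (ratr t) y)%:E)%E.
    have P1 (y : TL) : box x (x + const_mx h) y -> (0 <= (phi y)%:E)%E.
      by rewrite lee_fin.
    have P2 (y : TL) : box x (x + const_mx h) y -> (0 <= (below (ratr t) y)%:E)%E.
      by rewrite lee_fin.
    have P3 (y : TL) : box x (x + const_mx h) y ->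
        (0 <= (ratr t)%:E * (below (ratr t) y)%:E)%E.
      by move=> Qy; apply: mule_ge0; [rewrite lee_fin ltW|exact: P2].
    have M1 := mE _ (box x (x + const_mx h)) mphi.
    have M2 := mE _ (box x (x + const_mx h)) (mbelow (ratr t)).
    have M3 := measurable_funeM (ratr t)%:E M2.
    have t0' : (0 <= (ratr t)%:E :> \bar R)%E by rewrite lee_fin ltW.
    rewrite -(intC h _ h0 (ltW t0)) -(ge0_integralZl L (mQ h) M2 P2 t0').
    rewrite -(ge0_integralD L (mQ h) P1 M1 P3 M3).
    apply: integral_mono => y [xy yx]; first by rewrite lee_fin ltW.
    rewrite -EFinM -EFinD lee_fin.
    have yab : box a b y.
      by split; [apply: vle_trans xy; case: abx|apply: vle_trans yx xhb].
    rewrite /below indicE.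
    have [ty|yt] := ltP (ratr t) (phi y).
      by rewrite memNset ?mulr0 ?addr0; [exact: ltW|move=> [_ /(_ (conj yab ty))]].
    rewrite mem_set ?mulr1; first by rewrite lerDr.
    by split => // -[_ /=]; rewrite ltNge yt.
  have I_fin : (\int[L]_(y in box x (x + const_mx h)) (phi y)%:E)%E \is a fin_num.
    rewrite ge0_fin_numE; last by apply: integral_ge0 => y _; rewrite lee_fin.
    by apply: le_lt_trans (H1 h _) (ltry _); rewrite h0.
  have : ((ratr t * h ^+ n.+1)%:E <= \int[L]_(y in box x (x + const_mx h)) (phi y)%:E +
     (ratr t * (ratr r * h ^+ n.+1))%:E)%E.
    apply: le_trans key _; apply: leeD2l; rewrite [leRHS]EFinM; apply: lee_wpmul2l => //.
    by rewrite lee_fin ltW.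
  move: I_fin; case: (\int[L]_(y in _) _)%E => // I _.
  rewrite -EFinD !lee_fin => tI.
  have hn : 0 < h ^+ n.+1 by exact: exprn_gt0.
  apply: (@le_trans _ _ ((ratr t - ratr t * ratr r) * h ^+ n.+1)).
    by rewrite ler_pM2r//; lra.
  by rewrite mulrBl lerBlDr -(mulrA (ratr t)).
exists (Num.min h1 h2); first by rewrite lt_min h10.
move=> h /andP[h0]; rewrite lt_min => /andP[hh1 hh2].
by split; [apply: H2; rewrite h0|apply: H1; rewrite h0].
Qed.

End differentiation.

(** * The theorem *)

Section necessity.
Context {R : realType} {n : nat}.
Notation T := 'rV[R]_n.+1.
Notation TL := (caratheodory_type (@lebesgue_outer R n)).
Notation L := (lebesgue_rV R n).
Variables (a b : T) (f : T -> R).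
Hypotheses (ab : vle a b) (incf : jointly_increasing f a b)
  (acf : jointly_absolutely_continuous f a b).
Notation F := (joint_increment f).
Notation g := (joint_derivative f (box a b)).

Lemma joint_derivativeE (x : T) (l : R) : obox a b x ->
  (forall e, 0 < e -> exists2 h0, 0 < h0 & forall h, 0 < h < h0 ->
    (l - e) * h ^+ n.+1 <= F x (x + const_mx h) <= (l + e) * h ^+ n.+1) ->
  g x = l.
Proof.
move=> Ox H.
have cv : joint_quotient f x h @[h --> 0^'+] --> l.
  apply/cvgrPdist_le => e e0; have [h0 h00 Hh] := H e e0.
  apply/nbhs_ballP; exists h0 => //= h; rewrite /ball/= sub0r normrN => hh0 hpos.
  have hp : 0 < h by [].
  have hn : 0 < h ^+ n.+1 by exact: exprn_gt0.
  have /andP[l1 l2] : (l - e) * h ^+ n.+1 <= F x (x + const_mx h) <= (l + e) * h ^+ n.+1.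
    by apply: Hh; rewrite hp/= -[h]gtr0_norm.
  rewrite ler_distlC /joint_quotient; apply/andP; split.
    by rewrite ler_pdivlMr.
  by rewrite ler_pdivrMr.
rewrite /joint_derivative asboolT; first exact: cvg_lim cv.
split; first exact: obox_interior.
by apply/cvg_ex; exists l.
Qed.

Lemma integral_of_absolutely_continuous :
  (\int[L]_(x in box a b) (g x)%:E = (F a b)%:E)%E.
Proof.
have [phi [mphi phi0 intphi phiF]] := density_exists ab incf acf.
have [N N0 NP] := differentiation ab mphi phi0 intphi.
have gphi x : obox a b x -> ~ N x -> g x = phi x.
  move=> Ox nN; apply: joint_derivativeE => // e e0.
  have [h1 h10 H1] := NP x Ox nN e e0.
  have [h2 h20 H2] := small_cube_sub Ox.
  exists (Num.min h1 h2); first by rewrite lt_min h10.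
  move=> h /andP[h0]; rewrite lt_min => /andP[hh1 hh2].
  have [|l1 l2] := H1 h; first by rewrite h0.
  have xhb : vle (x + const_mx h) b by apply: H2; rewrite h0.
  have xh : vle x (x + const_mx h) by move=> i; rewrite !mxE lerDl ltW.
  have [ax _] := obox_box Ox.
  by rewrite phiF// in l1 l2; rewrite !lee_fin in l1 l2; apply/andP.
have g0 := joint_derivative_ge0 ab incf.
apply/eqP; rewrite eq_le; apply/andP; split.
  apply: le_trans (integral_joint_derivative_le ab incf (@vle_refl _ _ a) ab (@vle_refl _ _ b)).
  rewrite [leLHS]integral_mkcond [leRHS]integral_mkcond.
  apply: integral_mono => x _; rewrite !patchE.
    by case: ifP => // _; rewrite lee_fin.
  have [Ox|nO] := pselect (obox a b x).
    by rewrite !mem_set//; exact: obox_box.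
  rewrite [in leRHS]memNset//; case: ifP => // _.
  by rewrite joint_derivative_out.
(* cutting phi off on the exceptional null set puts it below the derivative *)
pose Z : set TL := N `|` (box a b `\` obox a b).
have Z0 : L Z = 0%E.
  apply/eqP; rewrite eq_le lebesgue_outer_ge0 andbT.
  apply: le_trans (outer_measureU2 (@lebesgue_outer R n) _ _) _.
  have -> : (0 = 0 + 0 :> \bar R)%E by rewrite adde0.
  apply: leeD; first by rewrite [X in (X <= _)%E]N0.
  by rewrite [X in (X <= _)%E](lebesgue_boundary ab).
have mZ : measurable Z by exact: lebesgue_null_measurable.
have mab : measurable (box a b : set TL) := borel_lebesgue (borel_box _ _).
have abZ0 : L (box a b `&` Z) = 0%E.
  apply/eqP; rewrite eq_le lebesgue_outer_ge0 andbT -[leRHS]Z0.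
  by apply: le_lebesgue_outer => x [].
pose phi' x := phi x * \1_(~` Z) x.
have mI : measurable_fun (setT : set TL) (\1_(~` Z) : TL -> R).
  by apply: measurable_indic; exact: measurableC.
have mphi' : measurable_fun (setT : set TL) phi' := measurable_funM mphi mI.
have phi'0 x : 0 <= phi' x by rewrite mulr_ge0// indicE ler0n.
rewrite -(phiF _ _ (@vle_refl _ _ a) ab (@vle_refl _ _ b)).
rewrite (integral_setD mphi phi0 mab mZ abZ0).
rewrite (eq_integral (fun x : TL => (phi' x)%:E)); last first.
  move=> x; rewrite inE => -[_ nZ]; rewrite /phi' indicE mem_set ?mulr1//.
rewrite -(integral_setD mphi' phi'0 mab mZ abZ0).
apply: integral_mono => x abx; first by rewrite lee_fin.
rewrite lee_fin /phi' indicE.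
have [Zx|nZ] := pselect (Z x); first by rewrite memNset ?mulr0//; exact.
rewrite mem_set// mulr1 gphi//.
- by apply: contrapT => nO; apply: nZ; right.
- by move=> Nx; apply: nZ; left.
Qed.

End necessity.

Theorem corollary1p3 (R : realType) (n : nat) (a b : 'rV[R]_n.+1)
    (f : 'rV[R]_n.+1 -> R) :
  (forall i, a ord0 i < b ord0 i) ->
  jointly_increasing f a b ->
  jointly_absolutely_continuous f a b <->
  (\int[lebesgue_rV R n]_(x in box a b) (joint_derivative f (box a b) x)%:E
    = (joint_increment f a b)%:E)%E.
Proof.
move=> ltab incf; have ab : vle a b by move=> i; exact: ltW.
split; first exact: integral_of_absolutely_continuous.
exact: absolutely_continuous_of_integral.
Qed.
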